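(* Let $x_0>0$ and $L>0$. (i) $\mathcal F$ admits a vertically symmetric area-preserving critical point $\gamma$ parametrized by arc length on $[0,2L]$ (i.e. of length $2L$) if and only if $3x_0<L$; in that case $\gamma=\gamma(x_0,L)$, and it is unique. (ii) For $\lambda\in\mathbb R$, $\mathcal F-\lambda\mathcal A$ admits a vertically symmetric critical point $\gamma$ parametrized by arc length on $[0,2L]$ if and only if $3x_0<L$ and $\lambda=\lambda(x_0,L)=\frac{2L}{L+x_0}$; in that case $\gamma=\gamma(x_0,L)$, and it is unique.
   Context: Notation: $(\xi,\eta)^\perp=(\eta,-\xi)$; for a regular curve $\gamma\in C^2([0,2L],\mathbb R^2)$, curvature $H=\langle\dot\gamma,\ddot\gamma^\perp\rangle/|\dot\gamma|^3$, normal $N=\dot\gamma^\perp/|\dot\gamma|$; strictly counterclockwise means $H>0$. A curve $\gamma=(x,y)$ is admissible if $\gamma\in C^\infty([0,2L],\mathbb R^2)$ is regular, strictly counterclockwise, injective, $\gamma(0)=(x_0,0)$, $\gamma(2L)=(-x_0,0)$, $y>0$ on $(0,2L)$. $\mathcal A(\gamma)=\frac12\int_0^{2L}(x\dot y-\dot xy)\,ds$, $\mathcal F(\gamma)=\int_0^{2L}|\dot\gamma|H^{-1}\,ds$. Vertically symmetric: support symmetric with respect to $\{x=0\}$. An admissible (resp. one-sided admissible) variation is a smooth $\mathcal V:[0,2L]\times[-t_{\mathcal V},t_{\mathcal V}]\to\mathbb R^2$ (resp. on $[0,2L]\times[0,t_{\mathcal V}]$) with $\mathcal V(\cdot,0)=\gamma$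 and each $\mathcal V(\cdot,t)$ admissible; it is area-preserving if $\mathcal A(\mathcal V(\cdot,t))$ is constant in $t$. An admissible $\gamma$ is an area-preserving critical point of $\mathcal F$ if $\frac d{dt}\mathcal F(\mathcal V(\cdot,t))|_{t=0}=0$ for every area-preserving admissible variation and the right derivative at $0$ is $\ge0$ for every area-preserving one-sided admissible variation. It is a critical point of $\mathcal F-\lambda\mathcal A$ if $\frac d{dt}(\mathcal F-\lambda\mathcal A)(\mathcal V(\cdot,t))|_{t=0}=0$ for every admissible variation and the right derivative is $\ge0$ for every one-sided admissible variation. For $0<3x_0<L$: with $\sigma=\pi\sqrt{x_0/(L+x_0)}$, $k=L/\sin\sigma$, $a(s)=\arcsin((s-L)/k)$, the curve $\gamma(x_0,L)=(x,y)$ on $[0,2L]$ is $x(s)=-\frac k2\big(\frac{\sigma}{\pi+\sigma}\sin(\tfrac{\pi+\sigma}{\sigma}a(s))+\frac{\sigma}{\pi-\sigma}\sin(\tfrac{\pi-\sigma}{\sigma}a(s))\big)$, $y(s)=\frac k2\big(\frac{\sigma}{\pi+\sigma}\cos(\tfrac{\pi+\sigma}{\sigma}a(s))+\frac{\sigma}{\pi-\sigma}\cos(\tfrac{\pi-\sigma}{\sigma}a(s))\big)+\frac{\pi x_0}{\sigma\tan\sigma}$. *)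

(* Defs.v *)
From Stdlib Require Import Reals Lra List.
From Coquelicot Require Import Coquelicot.
Open Scope R_scope.

(** Planar curves: parametrizations R -> R*R.  A curve in C^oo([0,2L],R^2) is
    represented by a C^oo function on all of R; all properties
    below only concern its restriction to [0,2L]. *)
Definition curve := R -> R * R.

Definition cx (g : curve) : R -> R := fun s => fst (g s).
Definition cy (g : curve) : R -> R := fun s => snd (g s).

Definition smooth1 (f : R -> R) : Prop := forall (n : nat) (s : R), ex_derive_n f n s.

Definition smooth_curve (g : curve) : Prop := smooth1 (cx g) /\ smooth1 (cy g).

Fixpoint iterpd (l : list bool) (g : R -> R -> R) : R -> R -> R :=
  match l with
  | nil => g
  | b :: l' =>
      let h := iterpd l' g in
      if b then (fun s t => Derive (fun u => h u t) s)
           else (fun s t => Derive (fun u => h s u) t)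
  end.

Definition smooth2 (g : R -> R -> R) : Prop :=
  forall (l : list bool) (s t : R),
    continuous (fun p : R * R => iterpd l g (fst p) (snd p)) (s, t) /\
    ex_derive (fun u => iterpd l g u t) s /\
    ex_derive (fun u => iterpd l g s u) t.

Definition smooth_variation (V : R -> R -> R * R) : Prop :=
  smooth2 (fun s t => fst (V s t)) /\ smooth2 (fun s t => snd (V s t)).

Definition slice (V : R -> R -> R * R) (t : R) : curve := fun s => V s t.

(** Speed |gamma'| and curvature H = <gamma', (gamma'')^perp> / |gamma'|^3,
    with (xi,eta)^perp = (eta,-xi), i.e. <gamma',gamma''^perp> = x'y'' - y'x''. *)
Definition speed (g : curve) (s : R) : R :=
  sqrt (Derive (cx g) s ^ 2 + Derive (cy g) s ^ 2).

Definition curvature (g : curve) (s : R) : R :=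
  (Derive (cx g) s * Derive (Derive (cy g)) s
   - Derive (cy g) s * Derive (Derive (cx g)) s) / (speed g s ^ 3).

Definition admissible (x0 L : R) (g : curve) : Prop :=
  smooth_curve g /\
  (forall s, 0 <= s <= 2 * L -> speed g s <> 0) /\
  (forall s, 0 <= s <= 2 * L -> 0 < curvature g s) /\
  (forall s1 s2, 0 <= s1 <= 2 * L -> 0 <= s2 <= 2 * L ->
       g s1 = g s2 -> s1 = s2) /\
  g 0 = (x0, 0) /\ g (2 * L) = (- x0, 0) /\
  (forall s, 0 < s < 2 * L -> 0 < cy g s).

Definition Acal (L : R) (g : curve) : R :=
  / 2 * RInt (fun s => cx g s * Derive (cy g) s - Derive (cx g) s * cy g s) 0 (2 * L).

Definition Fcal (L : R) (g : curve) : R :=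
  RInt (fun s => speed g s * / curvature g s) 0 (2 * L).

Definition vert_symmetric (L : R) (g : curve) : Prop :=
  forall s, 0 <= s <= 2 * L ->
    exists s', 0 <= s' <= 2 * L /\ g s' = (- cx g s, cy g s).

Definition arclength_param (L : R) (g : curve) : Prop :=
  forall s, 0 <= s <= 2 * L -> speed g s = 1.

Definition adm_variation (x0 L : R) (g : curve) (T : R) (V : R -> R -> R * R) : Prop :=
  0 < T /\ smooth_variation V /\
  (forall s, 0 <= s <= 2 * L -> V s 0 = g s) /\
  (forall t, - T <= t <= T -> admissible x0 L (slice V t)).

Definition adm_variation1 (x0 L : R) (g : curve) (T : R) (V : R -> R -> R * R) : Prop :=
  0 < T /\ smooth_variation V /\
  (forall s, 0 <= s <= 2 * L -> V s 0 = g s) /\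
  (forall t, 0 <= t <= T -> admissible x0 L (slice V t)).

Definition right_deriv_nonneg (f : R -> R) : Prop :=
  exists l : R, filterlim (fun h => (f h - f 0) / h) (at_right 0) (locally l) /\ 0 <= l.

Definition ap_critical (x0 L : R) (g : curve) : Prop :=
  admissible x0 L g /\
  (forall T V, adm_variation x0 L g T V ->
     (forall t, - T <= t <= T -> Acal L (slice V t) = Acal L (slice V 0)) ->
     is_derive (fun t => Fcal L (slice V t)) 0 0) /\
  (forall T V, adm_variation1 x0 L g T V ->
     (forall t, 0 <= t <= T -> Acal L (slice V t) = Acal L (slice V 0)) ->
     right_deriv_nonneg (fun t => Fcal L (slice V t))).

Definition lam_critical (x0 L lam : R) (g : curve) : Prop :=
  admissible x0 L g /\
  (forall T V, adm_variation x0 L g T V ->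
     is_derive (fun t => Fcal L (slice V t) - lam * Acal L (slice V t)) 0 0) /\
  (forall T V, adm_variation1 x0 L g T V ->
     right_deriv_nonneg (fun t => Fcal L (slice V t) - lam * Acal L (slice V t))).

Definition sigma0 (x0 L : R) : R := PI * sqrt (x0 / (L + x0)).
Definition k0 (x0 L : R) : R := L / sin (sigma0 x0 L).
Definition a0 (x0 L s : R) : R := asin ((s - L) / k0 x0 L).

Definition gamma0 (x0 L : R) : curve := fun s =>
  let sg := sigma0 x0 L in
  let k := k0 x0 L in
  let a := a0 x0 L s in
  ( - (k / 2) * (sg / (PI + sg) * sin ((PI + sg) / sg * a)
                 + sg / (PI - sg) * sin ((PI - sg) / sg * a)),
    (k / 2) * (sg / (PI + sg) * cos ((PI + sg) / sg * a)
               + sg / (PI - sg) * cos ((PI - sg) / sg * a))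
    + PI * x0 / (sg * tan sg) ).

(* Main.v *)
Require Import Defs.
From Stdlib Require Import Reals.
From Coquelicot Require Import Coquelicot.
From Stdlib Require Import Lra List Classical ClassicalEpsilon FunctionalExtensionality.
Open Scope R_scope.

(** In arc length write k for the curvature, r = 1/k and w for the variation field.  Two
    integrations by parts give
      d(F - lam A) = int ((lam - 2) - (r^2)'') <w, n> ds - [r^2 <w', n>],
    with n = (-y', x') and w = 0 at the ends.

    Necessity.  Moving only x keeps y > 0 and makes the area affine in t, so no implicit
    function argument is needed; these variations already force (r^2)'' = lam - 2 and
    y' = 0 at both ends, where then x' = 1.  With c = 1 - lam/2 one has (r r')' = -c, and
    (1-c) x - (r y' + r r' x') and (1-c) y + (r x' - r r' y') are first integrals.  Their
    end values give c = x0/(L+x0) and r(0) = r(2L), hence r^2 = c (K^2 - (s-L)^2), and the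
    tangent angle is (arcsin((s-L)/K) + arcsin(L/K)) / sqrt c.  Its total variation is a
    multiple of 2 pi; if it exceeded 2 pi, then y would be negative where the angle equals
    2 pi.  So arcsin(L/K) = pi sqrt c = sigma < pi/2, i.e. 3 x0 < L.

    Sufficiency.  The interior term vanishes, and y' = 0 at the ends is extremal among
    admissible curves, so the boundary term has the right sign.  The only delicate point
    is that a curve must be smooth on all of R, whereas r^2 has zeros at L-K and L+K: it is
    modified outside [0,2L] with the flat function exp(-1/z). *)

(** * Smooth functions of one and two variables *)

(** A horizontal field w = (phi, 0) has <w, n> = -y' phi. It detects the Euler-Lagrange equation
    everywhere although y' may vanish: if y' = 0 on an interval, then y'' = k x' = 0 there as well,
    against unit speed. At the ends <w', n> = -y' phi' with phi' free, which forces y' = 0; from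
    then on the constraint y > 0 makes vertical motions of the end tangents one-sided.

    The two first integrals are those that Noether's theorem attaches to translations: the integrand
    of F is invariant, and that of A changes by an exact derivative. Since the end tangents are (1,
    0), comparing end values gives c before the curve is known.

    K is half the distance between the zeros of the parabola r^2, and K > L because r > 0 on the
    closed interval. The bound 3 x0 < L is c < 1/4, that is sqrt c < 1/2: this is what arcsin(L/K) <
    pi/2 says once arcsin(L/K) = pi sqrt c. *)

(** [Derive_n] adds each new derivative on the outside. Here the innermost one is peeled off
    instead, so that the product and chain rules reduce level n+1 to level n for other functions. *)
Fixpoint Cn (n : nat) (f : R -> R) : Prop :=
  match n with
  | O => True
  | S m => (forall s, ex_derive f s) /\ Cn m (Derive f)
  end.

Lemma Derive_n_Derive (f : R -> R) (n : nat) (s : R) :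
  Derive_n (Derive f) n s = Derive_n f (S n) s.
Proof.
  revert s; induction n as [|n IH]; intro s; simpl; [reflexivity|].
  apply Derive_ext; intro t; exact (IH t).
Qed.

Lemma smooth1_step (f : R -> R) :
  smooth1 f <-> (forall s, ex_derive f s) /\ smooth1 (Derive f).
Proof.
  assert (E : forall n s, ex_derive_n (Derive f) (S n) s <-> ex_derive_n f (S (S n)) s).
  { intros n s; split; intro H.
    - apply (ex_derive_ext (Derive_n (Derive f) n)); [intro t; apply Derive_n_Derive | exact H].
    - apply (ex_derive_ext (Derive_n f (S n)));
        [intro t; symmetry; apply Derive_n_Derive | exact H]. }
  split.
  - intro H; split; [exact (fun s => H 1%nat s)|].
    intros [|n] s; [exact I|]. exact (proj2 (E n s) (H (S (S n)) s)).
  - intros [H0 H1] [|[|n]] s; [exact I | exact (H0 s) |]. exact (proj1 (E n s) (H1 (S n) s)).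
Qed.

Lemma smooth1_Cn (f : R -> R) : smooth1 f <-> forall n, Cn n f.
Proof.
  split.
  - intros H n; revert f H; induction n as [|n IH]; intros f H; [exact I|].
    apply smooth1_step in H; destruct H; split; auto.
  - intros H n s; revert f H s; induction n as [|n IH]; intros f H s; [exact I|].
    destruct n as [|n]; [exact (proj1 (H 1%nat) s)|].
    apply (ex_derive_ext (Derive_n (Derive f) n)); [intro t; apply Derive_n_Derive|].
    apply (IH (Derive f)); intro m; exact (proj2 (H (S m))).
Qed.

Lemma Cn_S (n : nat) (f : R -> R) : Cn (S n) f -> Cn n f.
Proof.
  revert f; induction n as [|n IH]; intros f H; [exact I|].
  destruct H as [H0 H1]; split; [exact H0 | exact (IH _ H1)].
Qed.

Lemma Cn_const (n : nat) (c : R) : Cn n (fun _ => c).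
Proof.
  revert c; induction n as [|n IH]; intro c; [exact I|]; split.
  - intro s; apply ex_derive_const.
  - replace (Derive (fun _ : R => c)) with (fun _ : R => 0); [apply IH|].
    extensionality s; symmetry; apply Derive_const.
Qed.

Lemma Cn_id (n : nat) : Cn n (fun s => s).
Proof.
  destruct n as [|n]; [exact I|]; split.
  - intro s; apply ex_derive_id.
  - replace (Derive (fun s : R => s)) with (fun _ : R => 1); [apply Cn_const|].
    extensionality s; symmetry; apply Derive_id.
Qed.

Lemma Cn_plus (n : nat) (f g : R -> R) : Cn n f -> Cn n g -> Cn n (fun s => f s + g s).
Proof.
  revert f g; induction n as [|n IH]; intros f g Hf Hg; [exact I|].
  destruct Hf as [Hf0 Hf], Hg as [Hg0 Hg]; split.
  - intro s; apply (ex_derive_plus f g); auto.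
  - replace (Derive (fun s => f s + g s)) with (fun s => Derive f s + Derive g s);
      [apply IH; auto|].
    extensionality s; symmetry; apply Derive_plus; auto.
Qed.

Lemma Cn_mult (n : nat) (f g : R -> R) : Cn n f -> Cn n g -> Cn n (fun s => f s * g s).
Proof.
  revert f g; induction n as [|n IH]; intros f g Hf Hg; [exact I|].
  pose proof (Cn_S _ _ Hf) as Hf'; pose proof (Cn_S _ _ Hg) as Hg'.
  destruct Hf as [Hf0 Hf], Hg as [Hg0 Hg]; split.
  - intro s; apply ex_derive_mult; auto.
  - replace (Derive (fun s => f s * g s)) with (fun s => Derive f s * g s + f s * Derive g s);
      [apply Cn_plus; auto|].
    extensionality s; symmetry; apply Derive_mult; auto.
Qed.

Lemma Cn_comp (n : nat) (f g : R -> R) : Cn n f -> Cn n g -> Cn n (fun s => f (g s)).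
Proof.
  revert f g; induction n as [|n IH]; intros f g Hf Hg; [exact I|].
  pose proof (Cn_S _ _ Hg) as Hg'.
  destruct Hf as [Hf0 Hf], Hg as [Hg0 Hg]; split.
  - intro s; apply (ex_derive_comp f g); auto.
  - replace (Derive (fun s => f (g s))) with (fun s => Derive g s * Derive f (g s));
      [apply Cn_mult; auto|].
    extensionality s; symmetry; apply Derive_comp; auto.
Qed.

Lemma smooth1_ex_derive (f : R -> R) (s : R) : smooth1 f -> ex_derive f s.
Proof. intro H; apply smooth1_step in H; apply H. Qed.

Lemma smooth1_Derive (f : R -> R) : smooth1 f -> smooth1 (Derive f).
Proof. intro H; apply smooth1_step in H; apply H. Qed.

Lemma smooth1_is_derive (f : R -> R) (s : R) : smooth1 f -> is_derive f s (Derive f s).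
Proof. intro H; apply Derive_correct, smooth1_ex_derive, H. Qed.

Lemma smooth1_continuous (f : R -> R) (s : R) : smooth1 f -> continuous f s.
Proof. intro H; apply (ex_derive_continuous f), smooth1_ex_derive, H. Qed.

Lemma smooth1_const (c : R) : smooth1 (fun _ => c).
Proof. apply smooth1_Cn; intro n; apply Cn_const. Qed.

Lemma smooth1_id : smooth1 (fun s => s).
Proof. apply smooth1_Cn; intro n; apply Cn_id. Qed.

Lemma smooth1_plus (f g : R -> R) : smooth1 f -> smooth1 g -> smooth1 (fun s => f s + g s).
Proof. rewrite !smooth1_Cn; intros; apply Cn_plus; auto. Qed.

Lemma smooth1_mult (f g : R -> R) : smooth1 f -> smooth1 g -> smooth1 (fun s => f s * g s).
Proof. rewrite !smooth1_Cn; intros; apply Cn_mult; auto. Qed.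

Lemma smooth1_comp (f g : R -> R) : smooth1 f -> smooth1 g -> smooth1 (fun s => f (g s)).
Proof. rewrite !smooth1_Cn; intros; apply Cn_comp; auto. Qed.

Lemma smooth1_opp (f : R -> R) : smooth1 f -> smooth1 (fun s => - f s).
Proof.
  intro H; replace (fun s => - f s) with (fun s => (-1) * f s).
  - apply smooth1_mult; [apply smooth1_const | exact H].
  - extensionality s; ring.
Qed.

Lemma smooth1_minus (f g : R -> R) : smooth1 f -> smooth1 g -> smooth1 (fun s => f s - g s).
Proof. intros; apply smooth1_plus; [|apply smooth1_opp]; auto. Qed.

Lemma smooth1_pow (f : R -> R) (n : nat) : smooth1 f -> smooth1 (fun s => f s ^ n).
Proof.
  intro H; induction n as [|n IH]; simpl; [apply smooth1_const | apply smooth1_mult; auto].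
Qed.

Lemma smooth1_of_derive (f df : R -> R) :
  (forall s, is_derive f s (df s)) -> smooth1 df -> smooth1 f.
Proof.
  intros H Hd; apply smooth1_step; split; [intro s; exists (df s); auto|].
  replace (Derive f) with df; [exact Hd|].
  extensionality s; symmetry; apply is_derive_unique, H.
Qed.

Lemma Cn_sin_cos (n : nat) : Cn n sin /\ Cn n cos.
Proof.
  induction n as [|n [IHs IHc]]; [split; exact I|]; repeat split.
  - intro s; eexists; apply is_derive_sin.
  - replace (Derive sin) with cos; [exact IHc|].
    extensionality s; symmetry; apply is_derive_unique, is_derive_sin.
  - intro s; eexists; apply is_derive_cos.
  - replace (Derive cos) with (fun s => (-1) * sin s).
    + apply Cn_mult; [apply Cn_const | exact IHs].
    + extensionality s; symmetry.
      rewrite (is_derive_unique _ _ _ (is_derive_cos s)); ring.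
Qed.

Lemma smooth1_sin : smooth1 sin.
Proof. apply smooth1_Cn; intro n; apply Cn_sin_cos. Qed.

Lemma smooth1_cos : smooth1 cos.
Proof. apply smooth1_Cn; intro n; apply Cn_sin_cos. Qed.

Ltac smooth1_tac :=
  repeat first
    [ assumption | apply smooth1_const | apply smooth1_id
    | apply (smooth1_plus _ _) | apply (smooth1_minus _ _) | apply (smooth1_mult _ _)
    | apply (smooth1_opp _) | apply (smooth1_pow _ _) | apply smooth1_Derive ].

Lemma smooth2_is_derive_s (f : R -> R -> R) (l : list bool) (s t : R) :
  smooth2 f -> is_derive (fun u => iterpd l f u t) s (iterpd (true :: l) f s t).
Proof. intro H; simpl; apply Derive_correct; exact (proj1 (proj2 (H l s t))). Qed.

Lemma smooth2_is_derive_t (f : R -> R -> R) (l : list bool) (s t : R) :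
  smooth2 f -> is_derive (fun u => iterpd l f s u) t (iterpd (false :: l) f s t).
Proof. intro H; simpl; apply Derive_correct; exact (proj2 (proj2 (H l s t))). Qed.

Lemma smooth2_continuity (f : R -> R -> R) (l : list bool) (s t : R) :
  smooth2 f -> continuity_2d_pt (iterpd l f) s t.
Proof. intro H; apply continuity_2d_pt_filterlim; exact (proj1 (H l s t)). Qed.

Lemma smooth2_Schwarz (f : R -> R -> R) (l : list bool) (s t : R) :
  smooth2 f -> iterpd (true :: false :: l) f s t = iterpd (false :: true :: l) f s t.
Proof.
  intro H; simpl. apply (Schwarz (iterpd l f)).
  - exists posreal_one; intros u v _ _; repeat split;
      [ exact (proj1 (proj2 (H l u v))) | exact (proj2 (proj2 (H l u v)))
      | exact (proj1 (proj2 (H (false :: l) u v)))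
      | exact (proj2 (proj2 (H (true :: l) u v)))].
  - exact (smooth2_continuity f (true :: false :: l) s t H).
  - exact (smooth2_continuity f (false :: true :: l) s t H).
Qed.

Lemma smooth2_slice (f : R -> R -> R) (l : list bool) (t : R) :
  smooth2 f -> smooth1 (fun s => iterpd l f s t).
Proof.
  intro H; apply smooth1_Cn; intro n; revert l; induction n as [|n IH]; intro l; [exact I|].
  split; [intro s; exact (proj1 (proj2 (H l s t)))|]. exact (IH (true :: l)).
Qed.

Lemma smooth2_Schwarz_sst (f : R -> R -> R) (s t : R) :
  smooth2 f -> iterpd (true :: true :: false :: nil) f s t
             = iterpd (false :: true :: true :: nil) f s t.
Proof.
  intro H; rewrite <- (smooth2_Schwarz f (true :: nil) s t H).
  simpl; apply Derive_ext; intro u; exact (smooth2_Schwarz f nil u t H).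
Qed.

Lemma continuity_2d_pt_swap (f : R -> R -> R) (x y : R) :
  continuity_2d_pt f x y -> continuity_2d_pt (fun u v => f v u) y x.
Proof.
  intros H eps; destruct (H eps) as [d Hd]; exists d; intros u v Hu Hv; apply Hd; auto.
Qed.

Lemma continuity_2d_of_smooth1 (p : R -> R) (s t : R) :
  smooth1 p -> continuity_2d_pt (fun u _ => p u) s t.
Proof.
  intro H; apply (continuity_1d_2d_pt_comp p (fun u _ => u)).
  - apply continuity_pt_filterlim, smooth1_continuous, H.
  - apply continuity_2d_pt_id1.
Qed.

(* [auto_derive] produces eta-expanded derivatives, which [ring] and [rewrite] do not identify with the contracted ones. *)
Ltac eta_Derive :=
  repeat match goal with
  | |- context [Derive (fun x => ?f x) ?s] => change (Derive (fun x => f x) s) with (Derive f s)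
  end.

(** Both partial derivatives preserve the shape p + t q with smooth coefficients, so every iterated
    derivative has it too. *)
Lemma smooth2_affine (p q : R -> R) :
  smooth1 p -> smooth1 q -> smooth2 (fun s t => p s + t * q s).
Proof.
  intros Hp Hq l.
  assert (E : exists p' q', smooth1 p' /\ smooth1 q' /\
    iterpd l (fun s t => p s + t * q s) = fun s t => p' s + t * q' s).
  { induction l as [|b l (p' & q' & Hp' & Hq' & IH)]; [exists p, q; auto|].
    simpl; rewrite IH; destruct b.
    - exists (Derive p'), (Derive q'); split; [|split]; try apply smooth1_Derive; auto.
      extensionality s; extensionality t; apply is_derive_unique.
      auto_derive; [repeat split; apply smooth1_ex_derive; auto | eta_Derive; ring].
    - exists q', (fun _ => 0); split; [|split]; [auto | apply smooth1_const |].
      extensionality s; extensionality t; apply is_derive_unique.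
      auto_derive; [auto | ring]. }
  destruct E as (p' & q' & Hp' & Hq' & ->); intros s t; split; [|split].
  - apply (continuity_2d_pt_filterlim (fun s t => p' s + t * q' s)).
    apply continuity_2d_pt_plus; [|apply continuity_2d_pt_mult];
      [apply continuity_2d_of_smooth1; auto | apply continuity_2d_pt_id2
      | apply continuity_2d_of_smooth1; auto].
  - auto_derive; repeat split; apply smooth1_ex_derive; auto.
  - auto_derive; auto.
Qed.

Lemma RInt_ext_le (f g : R -> R) (a b : R) :
  a <= b -> (forall s, a <= s <= b -> f s = g s) -> RInt f a b = RInt g a b.
Proof.
  intros Hab H; apply RInt_ext; rewrite Rmin_left, Rmax_right by assumption.
  intros s Hs; apply H; lra.
Qed.

(* Equations between integrals are elaborated in the carrier of a normed module, where [ring] and [field] do not apply. *)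
Ltac eq_in_R := match goal with |- @eq _ ?a ?b => change (@eq R a b) end.

Lemma RInt_zero (a b : R) : RInt (fun _ => 0) a b = 0.
Proof. rewrite RInt_const; apply Rmult_0_r. Qed.

(* Otherwise [apply] and [auto] unfold smoothness hypotheses and diverge. *)
Opaque smooth1 smooth2.

(** * Intervals: closures, constancy, compactness *)

Lemma continuous_ball (f : R -> R) (s : R) (eps : R) :
  continuous f s -> 0 < eps ->
  exists d, 0 < d /\ forall u, Rabs (u - s) < d -> Rabs (f u - f s) < eps.
Proof.
  intros H He.
  destruct (H (ball (f s) eps)) as [d Hd]; [exists (mkposreal eps He); auto|].
  exists d; split; [apply cond_pos|]; intros u Hu; exact (Hd u Hu).
Qed.

Lemma zero_on_closure (h : R -> R) (a b : R) :
  a < b -> (forall s, continuous h s) -> (forall s, a < s < b -> h s = 0) ->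
  forall s, a <= s <= b -> h s = 0.
Proof.
  intros Hab Hc H0 s Hs.
  destruct (Req_dec (h s) 0) as [|Hn]; [assumption|exfalso].
  destruct (continuous_ball h s (Rabs (h s)) (Hc s) (Rabs_pos_lt _ Hn)) as (d & Hd & Hball).
  (* Moving s by the fraction [e] towards the midpoint of [a,b] gives a point strictly inside and
     within d of s, even when s is an end. *)
  pose (e := Rmin (1 / 2) (d / (b - a))).
  assert (He : 0 < e <= 1 / 2 /\ e * (b - a) <= d).
  { unfold e; split; [split|].
    - apply Rmin_pos; [lra|]; apply Rdiv_lt_0_compat; lra.
    - apply Rmin_l.
    - apply Rle_trans with (d / (b - a) * (b - a)).
      + apply Rmult_le_compat_r; [lra | apply Rmin_r].
      + right; field; lra. }
  destruct He as [[He1 He2] He3].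
  assert (Hu : a < s + e * ((a + b) / 2 - s) < b) by (split; nra).
  specialize (Hball (s + e * ((a + b) / 2 - s))).
  rewrite (H0 _ Hu) in Hball.
  replace (0 - h s) with (- h s) in Hball by ring; rewrite Rabs_Ropp in Hball.
  apply (Rlt_irrefl (Rabs (h s))), Hball.
  replace (s + e * ((a + b) / 2 - s) - s) with (e * ((a + b) / 2 - s)) by ring.
  apply Rabs_def1; nra.
Qed.

(** [Derive] is two-sided while curves are compared on [0,2L] only. Inside the interval the
    agreement is local; at the ends it follows by continuity of the derivatives. *)
Lemma Derive_eq_on_interval (f g : R -> R) (a b : R) :
  a < b -> smooth1 f -> smooth1 g -> (forall s, a <= s <= b -> f s = g s) ->
  forall s, a <= s <= b -> Derive f s = Derive g s.
Proof.
  intros Hab Hf Hg E s Hs; apply Rminus_diag_uniq.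
  apply (zero_on_closure (fun s => Derive f s - Derive g s) a b); auto.
  - intro u; apply smooth1_continuous; smooth1_tac.
  - intros u Hu; apply Rminus_diag_eq, Derive_ext_loc.
    assert (Hp : 0 < Rmin (u - a) (b - u)) by (apply Rmin_pos; lra).
    exists (mkposreal _ Hp); intros v Hv; apply E.
    change (Rabs (v - u) < Rmin (u - a) (b - u)) in Hv.
    pose proof (Rmin_l (u - a) (b - u)); pose proof (Rmin_r (u - a) (b - u)).
    apply Rabs_def2 in Hv; lra.
Qed.

Lemma eq_of_derive_eq (f g d : R -> R) (a b : R) :
  (forall s, a <= s <= b -> is_derive f s (d s)) ->
  (forall s, a <= s <= b -> is_derive g s (d s)) ->
  forall s s0, a <= s <= b -> a <= s0 <= b -> f s - f s0 = g s - g s0.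
Proof.
  intros Hf Hg s s0 Hs Hs0.
  assert (In : forall u, Rmin s0 s <= u <= Rmax s0 s -> a <= u <= b).
  { intros u Hu; revert Hu; unfold Rmin, Rmax; destruct (Rle_dec s0 s); lra. }
  destruct (MVT_gen (fun s => f s - g s) s0 s (fun _ => 0)) as (c & _ & Hc).
  - intros u Hu; replace 0 with (d u - d u) by ring.
    apply (is_derive_minus f g); [apply Hf | apply Hg]; apply In; lra.
  - intros u Hu; apply continuity_pt_filterlim, (ex_derive_continuous (fun s => f s - g s)).
    exists (d u - d u); apply (is_derive_minus f g); [apply Hf | apply Hg]; apply In; lra.
  - lra.
Qed.

(** All partial integrals from a are squeezed to 0, so their derivative, which is f, vanishes
    inside; continuity covers the ends. *)
Lemma RInt_nonneg_eq_0 (f : R -> R) (a b : R) :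
  a < b -> (forall s, continuous f s) -> (forall s, a <= s <= b -> 0 <= f s) ->
  RInt f a b = 0 -> forall s, a <= s <= b -> f s = 0.
Proof.
  intros Hab Hc Hp HI.
  assert (Ex : forall u v, ex_RInt f u v) by (intros; apply (ex_RInt_continuous f); auto).
  assert (Hz : forall z, a <= z <= b -> RInt f a z = 0).
  { intros z Hz.
    assert (H1 : 0 <= RInt f a z) by (apply RInt_ge_0; [lra | auto | intros; apply Hp; lra]).
    assert (H2 : 0 <= RInt f z b) by (apply RInt_ge_0; [lra | auto | intros; apply Hp; lra]).
    pose proof (RInt_Chasles f a z b (Ex _ _) (Ex _ _)) as H3.
    change (RInt f a z + RInt f z b = RInt f a b) in H3; lra. }
  apply zero_on_closure; auto.
  intros s Hs.
  assert (D1 : is_derive (fun z => RInt f a z) s (f s)).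
  { apply (is_derive_RInt f _ a); [|auto].
    exists posreal_one; intros y _; apply (RInt_correct f), Ex. }
  assert (D2 : is_derive (fun z => RInt f a z) s 0).
  { apply (is_derive_ext_loc (fun _ => 0)); [|apply (is_derive_const 0)].
    assert (Hp' : 0 < Rmin (s - a) (b - s)) by (apply Rmin_pos; lra).
    exists (mkposreal _ Hp'); intros v Hv; symmetry; apply Hz.
    change (Rabs (v - s) < Rmin (s - a) (b - s)) in Hv.
    pose proof (Rmin_l (s - a) (b - s)); pose proof (Rmin_r (s - a) (b - s)).
    apply Rabs_def2 in Hv; lra. }
  apply is_derive_unique in D1; apply is_derive_unique in D2; congruence.
Qed.

Lemma smooth1_MVT (h : R -> R) (a b : R) :
  smooth1 h -> a < b -> exists c, a < c < b /\ h b - h a = Derive h c * (b - a).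
Proof.
  intros Hh Hab; destruct (MVT_cor2 h (Derive h) a b Hab) as (c & E & Hc).
  - intros c _; apply is_derive_Reals, smooth1_is_derive, Hh.
  - exists c; auto.
Qed.

Lemma local_concave_negative (f : R -> R) (a : R) :
  smooth1 f -> f a = 0 -> Derive f a = 0 -> Derive (Derive f) a < 0 ->
  exists d, 0 < d /\ forall s, s <> a -> Rabs (s - a) < d -> f s < 0.
Proof.
  intros Hf H0 H1 H2.
  assert (Hf1 : smooth1 (Derive f)) by (apply smooth1_Derive; exact Hf).
  destruct (continuous_ball (Derive (Derive f)) a (- Derive (Derive f) a))
    as (d & Hd & Hball); [apply smooth1_continuous; smooth1_tac | lra |].
  assert (Neg : forall e, Rabs (e - a) < d -> Derive (Derive f) e < 0).
  { intros e He; apply Hball, Rabs_def2 in He; lra. }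
  exists d; split; [exact Hd|]; intros s Hsa Hs; apply Rabs_def2 in Hs.
  destruct (Rlt_le_dec a s) as [Hlt|Hle].
  - destruct (smooth1_MVT f a s Hf Hlt) as (c & Hc & Ec).
    destruct (smooth1_MVT (Derive f) a c Hf1 (proj1 Hc)) as (e & He & Ee).
    assert (Derive (Derive f) e < 0) by (apply Neg, Rabs_def1; lra).
    assert (Derive f c < 0) by nra. nra.
  - assert (Hlt : s < a) by lra.
    destruct (smooth1_MVT f s a Hf Hlt) as (c & Hc & Ec).
    destruct (smooth1_MVT (Derive f) c a Hf1 (proj2 Hc)) as (e & He & Ee).
    assert (Derive (Derive f) e < 0) by (apply Neg, Rabs_def1; lra).
    assert (0 < Derive f c) by nra. nra.
Qed.

Lemma pos_choice (P : R -> posreal -> Prop) :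
  (forall s, exists d, P s d) -> exists f : R -> posreal, forall s, P s (f s).
Proof.
  intro H.
  exists (fun s => proj1_sig (constructive_indefinite_description _ (H s))).
  intro s; apply proj2_sig.
Qed.

(** Tube lemma: compactness of [a,b] makes the local radii uniform, which keeps speed and curvature
    positive for all small t at once. [compactness_value_1d] gives its centre only under a double
    negation, hence [NNPP]. *)
Lemma pos_near_segment (G : R -> R -> R) (a b : R) :
  (forall s, a <= s <= b -> continuity_2d_pt G s 0) ->
  (forall s, a <= s <= b -> 0 < G s 0) ->
  exists d : posreal, forall s t, a <= s <= b -> Rabs t < d -> 0 < G s t.
Proof.
  intros Hc Hp.
  destruct (pos_choice (fun s d => a <= s <= b ->
    forall u v, Rabs (u - s) < d -> Rabs v < d -> 0 < G u v)) as [f Hf].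
  - intro s; destruct (classic (a <= s <= b)) as [Hs|Hs]; [|exists posreal_one; tauto].
    destruct (Hc s Hs (mkposreal _ (Hp s Hs))) as [d Hd]; exists d; intros _ u v Hu Hv.
    specialize (Hd u v Hu); simpl in Hd; rewrite Rminus_0_r in Hd.
    specialize (Hd Hv); apply Rabs_def2 in Hd; lra.
  - destruct (compactness_value_1d a b f) as [d Hd]; exists d; intros s t Hs Ht.
    apply NNPP; intro Hn; apply (Hd s Hs); intros (u & Hu & Hsu & Hdu).
    apply Hn, (Hf u Hu); lra.
Qed.

(** Injectivity alone is not stable under perturbation. The compactness argument runs over pairs in
    the square, and on the diagonal, where values cannot be separated, the immersion hypothesis
    takes over. *)
Lemma injective_near_segment (G H Gs Hs : R -> R -> R) (a b : R) :
  (forall s t, is_derive (fun u => G u t) s (Gs s t)) ->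
  (forall s t, is_derive (fun u => H u t) s (Hs s t)) ->
  (forall s, continuity_2d_pt G s 0) -> (forall s, continuity_2d_pt H s 0) ->
  (forall s, continuity_2d_pt Gs s 0) -> (forall s, continuity_2d_pt Hs s 0) ->
  (forall s, a <= s <= b -> Gs s 0 <> 0 \/ Hs s 0 <> 0) ->
  (forall s1 s2, a <= s1 <= b -> a <= s2 <= b ->
     G s1 0 = G s2 0 -> H s1 0 = H s2 0 -> s1 = s2) ->
  exists d : posreal, forall s1 s2 t, a <= s1 <= b -> a <= s2 <= b -> Rabs t < d ->
     G s1 t = G s2 t -> H s1 t = H s2 t -> s1 = s2.
Proof.
  intros HG HH cG cH cGs cHs Himm Hinj.
  (* away from the diagonal the values stay apart; near it one derivative does not vanish *)
  assert (Far : forall F : R -> R -> R, (forall s, continuity_2d_pt F s 0) ->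
    forall p q, F p 0 <> F q 0 -> exists d : posreal, forall s1 s2 t,
      Rabs (s1 - p) < d -> Rabs (s2 - q) < d -> Rabs t < d -> F s1 t <> F s2 t).
  { intros F cF p q Hpq.
    assert (He : 0 < Rabs (F p 0 - F q 0) / 2).
    { assert (0 < Rabs (F p 0 - F q 0)) by (apply Rabs_pos_lt; lra). lra. }
    destruct (cF p (mkposreal _ He)) as [d1 Hd1]; destruct (cF q (mkposreal _ He)) as [d2 Hd2].
    exists (mkposreal _ (Rmin_pos _ _ (cond_pos d1) (cond_pos d2))); simpl.
    intros s1 s2 t H1 H2 Ht E.
    pose proof (Rmin_l d1 d2); pose proof (Rmin_r d1 d2).
    assert (A1 : Rabs (F s1 t - F p 0) < Rabs (F p 0 - F q 0) / 2).
    { apply Hd1; [lra | rewrite Rminus_0_r; lra]. }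
    assert (A2 : Rabs (F s2 t - F q 0) < Rabs (F p 0 - F q 0) / 2).
    { apply Hd2; [lra | rewrite Rminus_0_r; lra]. }
    rewrite E in A1; revert A1 A2; unfold Rabs; repeat destruct Rcase_abs; lra. }
  assert (Near : forall F Fs : R -> R -> R, (forall s t, is_derive (fun u => F u t) s (Fs s t)) ->
    (forall s, continuity_2d_pt Fs s 0) ->
    forall p, Fs p 0 <> 0 -> exists d : posreal, forall s1 s2 t,
      Rabs (s1 - p) < d -> Rabs (s2 - p) < d -> Rabs t < d -> F s1 t = F s2 t -> s1 = s2).
  { intros F Fs dF cFs p Hp.
    destruct (continuity_2d_pt_neq_0 Fs p 0 (cFs p) Hp) as [d Hd].
    exists d; intros s1 s2 t H1 H2 Ht E.
    destruct (MVT_gen (fun u => F u t) s1 s2 (fun u => Fs u t)) as (c & Hc & Ec).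
    - intros u _; apply dF.
    - intros u _; apply continuity_pt_filterlim, (ex_derive_continuous (fun u => F u t)).
      eexists; apply dF.
    - rewrite E, Rminus_diag_eq in Ec by reflexivity.
      assert (Fs c t <> 0).
      { apply Hd; [|rewrite Rminus_0_r; exact Ht].
        apply Rabs_def2 in H1; apply Rabs_def2 in H2; apply Rabs_def1;
          revert Hc; unfold Rmin, Rmax; destruct (Rle_dec s1 s2); lra. }
      symmetry in Ec; apply Rmult_integral in Ec; destruct Ec; lra. }
  assert (Loc : forall p q, exists d : posreal, a <= p <= b -> a <= q <= b ->
    forall s1 s2 t, Rabs (s1 - p) < d -> Rabs (s2 - q) < d -> Rabs t < d ->
      G s1 t = G s2 t -> H s1 t = H s2 t -> s1 = s2).
  { intros p q; destruct (classic (a <= p <= b /\ a <= q <= b)) as [[Hp Hq]|Hn];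
      [|exists posreal_one; tauto].
    destruct (Req_dec p q) as [<-|Hpq].
    - destruct (Himm p Hp) as [Hx|Hx].
      + destruct (Near G Gs HG cGs p Hx) as [d Hd]; exists d; eauto.
      + destruct (Near H Hs HH cHs p Hx) as [d Hd]; exists d; eauto.
    - destruct (Req_dec (G p 0) (G q 0)) as [E|Hx].
      + destruct (Far H cH p q) as [d Hd]; [intro E'; auto|].
        exists d; intros _ _ s1 s2 t H1 H2 Ht _ E2; exfalso; exact (Hd _ _ _ H1 H2 Ht E2).
      + destruct (Far G cG p q Hx) as [d Hd].
        exists d; intros _ _ s1 s2 t H1 H2 Ht E1 _; exfalso; exact (Hd _ _ _ H1 H2 Ht E1). }
  pose (f p q := proj1_sig (constructive_indefinite_description _ (Loc p q))).
  assert (Hf : forall p q, a <= p <= b -> a <= q <= b -> forall s1 s2 t,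
    Rabs (s1 - p) < f p q -> Rabs (s2 - q) < f p q -> Rabs t < f p q ->
    G s1 t = G s2 t -> H s1 t = H s2 t -> s1 = s2).
  { intros p q; exact (proj2_sig (constructive_indefinite_description _ (Loc p q))). }
  destruct (compactness_value_2d a b a b f) as [d Hd].
  exists d; intros s1 s2 t H1 H2 Ht E1 E2; apply NNPP; intro Hn.
  apply (Hd s1 s2 H1 H2); intros (p & q & Hp & Hq & Hsp & Hsq & Hdpq).
  apply Hn, (Hf p q Hp Hq s1 s2 t); auto; lra.
Qed.

(** * First variation *)

(** The square roots cancel: speed/H = Q^2/K with Q the squared speed and K the curvature numerator.
    The integrand becomes rational, and only K has to stay away from 0. The convention / 0 = 0 makes
    the identity unconditional. *)
Lemma Fcal_eq (L : R) (g : curve) :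
  Fcal L g = RInt (fun s => (Derive (cx g) s ^ 2 + Derive (cy g) s ^ 2) ^ 2
    / (Derive (cx g) s * Derive (Derive (cy g)) s
       - Derive (cy g) s * Derive (Derive (cx g)) s)) 0 (2 * L).
Proof.
  apply RInt_ext; intros s _; unfold curvature, speed.
  set (Q := Derive (cx g) s ^ 2 + _); set (K := _ - _).
  assert (HQ : 0 <= Q) by (unfold Q; nra).
  assert (E : sqrt Q * / (K / sqrt Q ^ 3) = Q ^ 2 / K); [|exact E].
  unfold Rdiv; rewrite Rinv_mult, Rinv_inv.
  rewrite <- (sqrt_sqrt Q HQ) at 3; ring.
Qed.

Lemma is_derive_F_integrand (p q p2 q2 : R -> R) (t dp dq dp2 dq2 : R) :
  is_derive p t dp -> is_derive q t dq -> is_derive p2 t dp2 -> is_derive q2 t dq2 ->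
  let K := p t * q2 t - q t * p2 t in
  let Q := p t ^ 2 + q t ^ 2 in
  K <> 0 ->
  is_derive (fun t => (p t ^ 2 + q t ^ 2) ^ 2 / (p t * q2 t - q t * p2 t)) t
    (4 * Q * (p t * dp + q t * dq) / K
     - Q ^ 2 * (dp * q2 t + p t * dq2 - dq * p2 t - q t * dp2) / K ^ 2).
Proof.
  intros Hp Hq Hp2 Hq2 K Q HK; unfold K, Q in *.
  assert (ex_derive p t) by (eexists; eauto). assert (ex_derive q t) by (eexists; eauto).
  assert (ex_derive p2 t) by (eexists; eauto). assert (ex_derive q2 t) by (eexists; eauto).
  auto_derive; [repeat split; auto|]; eta_Derive.
  rewrite (is_derive_unique _ _ _ Hp), (is_derive_unique _ _ _ Hq),
    (is_derive_unique _ _ _ Hp2), (is_derive_unique _ _ _ Hq2).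
  field; exact HK.
Qed.

Lemma is_derive_Fcal_param (L : R) (V : R -> R -> R * R) :
  0 < L -> smooth_variation V ->
  let f := fun s t => fst (V s t) in
  let h := fun s t => snd (V s t) in
  let D := fun (F : R -> R -> R) (l : list bool) s => iterpd l F s 0 in
  let b := true in let c := false in
  (forall s, 0 <= s <= 2 * L ->
     0 < D f (b::nil) s * D h (b::b::nil) s - D h (b::nil) s * D f (b::b::nil) s) ->
  is_derive (fun t => Fcal L (slice V t)) 0
    (RInt (fun s =>
       let Q := D f (b::nil) s ^ 2 + D h (b::nil) s ^ 2 in
       let K := D f (b::nil) s * D h (b::b::nil) s - D h (b::nil) s * D f (b::b::nil) s in
       4 * Q * (D f (b::nil) s * D f (b::c::nil) s + D h (b::nil) s * D h (b::c::nil) s) / K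
       - Q ^ 2 * (D f (b::c::nil) s * D h (b::b::nil) s + D f (b::nil) s * D h (b::b::c::nil) s
             - D h (b::c::nil) s * D f (b::b::nil) s - D h (b::nil) s * D f (b::b::c::nil) s)
         / K ^ 2) 0 (2 * L)).
Proof.
  intros HL [Sf Sh] f h D b c HK.
  pose (I := fun F l s t => iterpd l F s t).
  pose (Kt := fun s t => I f (b::nil) s t * I h (b::b::nil) s t
                         - I h (b::nil) s t * I f (b::b::nil) s t).
  pose (G := fun t s => (I f (b::nil) s t ^ 2 + I h (b::nil) s t ^ 2) ^ 2 / Kt s t).
  pose (dG := fun t s => 
       let Q := I f (b::nil) s t ^ 2 + I h (b::nil) s t ^ 2 in
       4 * Q * (I f (b::nil) s t * I f (c::b::nil) s t + I h (b::nil) s t * I h (c::b::nil) s t) / Kt s t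
       - Q ^ 2 * (I f (c::b::nil) s t * I h (b::b::nil) s t + I f (b::nil) s t * I h (c::b::b::nil) s t
             - I h (c::b::nil) s t * I f (b::b::nil) s t - I h (b::nil) s t * I f (c::b::b::nil) s t)
         / Kt s t ^ 2).
  assert (Cf : forall l s t, continuity_2d_pt (I f l) s t) by (intros; apply smooth2_continuity, Sf).
  assert (Ch : forall l s t, continuity_2d_pt (I h l) s t) by (intros; apply smooth2_continuity, Sh).
  assert (CK : forall s t, continuity_2d_pt Kt s t).
  { intros; unfold Kt; repeat first [apply continuity_2d_pt_minus | apply continuity_2d_pt_mult];
      first [apply Cf | apply Ch]. }
  assert (dGt : forall s t, Kt s t <> 0 -> is_derive (fun u => G u s) t (dG t s)).
  { intros s t HKt.
    exact (is_derive_F_integrand (fun u => I f (b::nil) s u) (fun u => I h (b::nil) s u)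
      (fun u => I f (b::b::nil) s u) (fun u => I h (b::b::nil) s u) t _ _ _ _
      (smooth2_is_derive_t f (b::nil) s t Sf) (smooth2_is_derive_t h (b::nil) s t Sh)
      (smooth2_is_derive_t f (b::b::nil) s t Sf) (smooth2_is_derive_t h (b::b::nil) s t Sh) HKt). }
  assert (CG : forall s t, Kt s t <> 0 -> continuity_2d_pt dG t s).
  { intros s t HKt; apply continuity_2d_pt_swap with (f := fun s t => dG t s); unfold dG.
    repeat first [ apply Cf | apply Ch | apply CK | apply continuity_2d_pt_const
      | apply continuity_2d_pt_minus | apply continuity_2d_pt_plus
      | apply continuity_2d_pt_mult | (apply continuity_2d_pt_inv; [| simpl; nra]) ]. }
  (* Positivity of the curvature numerator is known at t = 0 only, but differentiating under the
     integral needs it for all small t. *)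
  destruct (pos_near_segment Kt 0 (2 * L)) as [d Hd]; [auto | exact HK |].
  assert (HKd : forall t s, Rabs t < d -> 0 <= s <= 2 * L -> Kt s t <> 0).
  { intros t s Ht Hs; apply Rgt_not_eq, Hd; auto. }
  assert (R0 : Rmin 0 (2 * L) = 0) by (apply Rmin_left; lra).
  assert (R1 : Rmax 0 (2 * L) = 2 * L) by (apply Rmax_right; lra).
  assert (Hloc : forall P : R -> Prop, (forall t, Rabs t < d -> P t) -> locally 0 P).
  { intros P HP; exists d; intros t Ht; apply HP.
    change (Rabs (t - 0) < d) in Ht; rewrite Rminus_0_r in Ht; exact Ht. }
  apply (is_derive_ext (fun t => RInt (fun s => G t s) 0 (2 * L))).
  { intro t; symmetry; apply Fcal_eq. }
  replace (RInt _ 0 (2 * L)) with (RInt (fun s => Derive (fun u => G u s) 0) 0 (2 * L)).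
  - apply is_derive_RInt_param; rewrite ?R0, ?R1.
    + apply Hloc; intros t Ht s Hs; eexists; apply dGt, HKd; auto.
    + intros s Hs.
      apply continuity_2d_pt_ext_loc with (f := dG).
      * destruct (continuity_2d_pt_neq_0 Kt s 0 (CK s 0)) as [e He].
        { apply HKd; [rewrite Rabs_R0; apply cond_pos | exact Hs]. }
        exists e; intros u v Hu Hv; symmetry; apply is_derive_unique, dGt, He; auto.
      * apply CG, HKd; [rewrite Rabs_R0; apply cond_pos | exact Hs].
    + apply Hloc; intros t Ht; apply (ex_RInt_continuous (fun s => G t s)).
      rewrite R0, R1; intros s Hs.
      apply (ex_derive_continuous (fun s => G t s)); eexists.
      assert (Ef : forall l, is_derive (fun s => I f l s t) s (I f (b::l) s t))
        by (intro l; exact (smooth2_is_derive_s f l s t Sf)).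
      assert (Eh : forall l, is_derive (fun s => I h l s t) s (I h (b::l) s t))
        by (intro l; exact (smooth2_is_derive_s h l s t Sh)).
      exact (is_derive_F_integrand (fun s => I f (b::nil) s t) (fun s => I h (b::nil) s t)
        (fun s => I f (b::b::nil) s t) (fun s => I h (b::b::nil) s t) s _ _ _ _
        (Ef _) (Eh _) (Ef _) (Eh _) (HKd t s Ht Hs)).
  - apply RInt_ext; intros s Hs; rewrite R0, R1 in Hs.
    transitivity (dG 0 s).
    + apply is_derive_unique, dGt, HKd; [rewrite Rabs_R0; apply cond_pos | lra].
    (* In [dG] the t-derivative is outermost. The statement has it innermost, so that its terms are
       s-derivatives of the variation field; Schwarz exchanges the two. *)
    + unfold dG, I, Kt, D, b, c.
      rewrite (smooth2_Schwarz_sst f s 0 Sf), (smooth2_Schwarz_sst h s 0 Sh).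
      rewrite (smooth2_Schwarz f nil s 0 Sf), (smooth2_Schwarz h nil s 0 Sh).
      reflexivity.
Qed.

Definition curv_num (x y : R -> R) (s : R) : R :=
  Derive x s * Derive (Derive y) s - Derive y s * Derive (Derive x) s.

Lemma smooth1_curv_num (x y : R -> R) : smooth1 x -> smooth1 y -> smooth1 (curv_num x y).
Proof. intros Hx Hy; unfold curv_num; smooth1_tac. Qed.

Definition unit_speed (x y : R -> R) (L : R) : Prop :=
  forall s, 0 <= s <= 2 * L -> Derive x s ^ 2 + Derive y s ^ 2 = 1.

(** Differentiating the unit speed relation shows that the acceleration is orthogonal to the unit
    tangent. It is therefore a multiple of the rotated tangent, and the factor is the curvature
    numerator. *)
Lemma frenet (x y : R -> R) (L : R) :
  0 < L -> smooth1 x -> smooth1 y -> unit_speed x y L ->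
  forall s, 0 <= s <= 2 * L ->
    Derive (Derive x) s = - curv_num x y s * Derive y s /\
    Derive (Derive y) s = curv_num x y s * Derive x s.
Proof.
  intros HL Hx Hy U s Hs.
  assert (E : Derive x s * Derive (Derive x) s + Derive y s * Derive (Derive y) s = 0).
  { assert (D : Derive (fun s => Derive x s ^ 2 + Derive y s ^ 2) s
      = Derive (fun _ => 1) s).
    { apply (Derive_eq_on_interval _ _ 0 (2 * L)); [lra | smooth1_tac | smooth1_tac | exact U | exact Hs]. }
    rewrite Derive_const in D.
    assert (Hx1 : ex_derive (Derive x) s) by (apply smooth1_ex_derive; smooth1_tac).
    assert (Hy1 : ex_derive (Derive y) s) by (apply smooth1_ex_derive; smooth1_tac).
    assert (D' : is_derive (fun s => Derive x s ^ 2 + Derive y s ^ 2) s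
      (2 * (Derive x s * Derive (Derive x) s + Derive y s * Derive (Derive y) s))).
    { auto_derive; [repeat split; auto | eta_Derive; ring]. }
    apply is_derive_unique in D'; pose proof (eq_trans (eq_sym D') D) as D2; lra. }
  specialize (U s Hs); unfold curv_num.
  split.
  - replace (Derive (Derive x) s)
      with (Derive (Derive x) s * (Derive x s ^ 2 + Derive y s ^ 2)) at 1 by (rewrite U; ring).
    replace (Derive (Derive x) s * (Derive x s ^ 2 + Derive y s ^ 2)) with
      (Derive x s * (Derive x s * Derive (Derive x) s + Derive y s * Derive (Derive y) s)
       - (Derive x s * Derive (Derive y) s - Derive y s * Derive (Derive x) s) * Derive y s) by ring.
    rewrite E; ring.
  - replace (Derive (Derive y) s)
      with (Derive (Derive y) s * (Derive x s ^ 2 + Derive y s ^ 2)) at 1 by (rewrite U; ring).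
    replace (Derive (Derive y) s * (Derive x s ^ 2 + Derive y s ^ 2)) with
      (Derive y s * (Derive x s * Derive (Derive x) s + Derive y s * Derive (Derive y) s)
       + (Derive x s * Derive (Derive y) s - Derive y s * Derive (Derive x) s) * Derive x s) by ring.
    rewrite E; ring.
Qed.

(* (r^2)'' + 2 for the radius of curvature r = 1/k: the Euler-Lagrange expression of F. *)
Definition EL_expr (k : R -> R) (s : R) : R :=
  2 - 2 * Derive (Derive k) s / k s ^ 3 + 6 * Derive k s ^ 2 / k s ^ 4.

(* Integrating the first variation by parts twice produces the total derivative of this function. *)
Definition bdry (x y u v k : R -> R) (lam s : R) : R :=
  2 * (Derive x s * u s + Derive y s * v s) / k s
  - 2 * Derive k s / k s ^ 3 * (Derive x s * v s - Derive y s * u s)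
  - (Derive x s * Derive v s - Derive y s * Derive u s) / k s ^ 2
  - lam / 2 * (x s * v s - y s * u s).

(** Both integrations by parts in one differentiation: at unit speed the result is the linearised
    integrand of F, minus [lam] times that of A, minus the Euler-Lagrange term paired with <w,
    n>. *)
Lemma bdry_derive (x y u v k : R -> R) (lam s : R) :
  smooth1 x -> smooth1 y -> smooth1 u -> smooth1 v -> smooth1 k ->
  0 < k s -> Derive x s ^ 2 + Derive y s ^ 2 = 1 ->
  Derive (Derive x) s = - k s * Derive y s -> Derive (Derive y) s = k s * Derive x s ->
  is_derive (bdry x y u v k lam) s
    (4 * (Derive x s * Derive u s + Derive y s * Derive v s) / k s
     - (Derive u s * Derive (Derive y) s + Derive x s * Derive (Derive v) s
        - Derive v s * Derive (Derive x) s - Derive y s * Derive (Derive u) s) / k s ^ 2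
     - lam / 2 * (u s * Derive y s + x s * Derive v s - Derive u s * y s - Derive x s * v s)
     - (lam - EL_expr k s) * (Derive x s * v s - Derive y s * u s)).
Proof.
  intros Hx Hy Hu Hv Hk Hks U Ex Ey.
  assert (S : forall f, smooth1 f -> ex_derive f s) by (intros; apply smooth1_ex_derive; auto).
  pose proof (smooth1_Derive _ Hx); pose proof (smooth1_Derive _ Hy).
  pose proof (smooth1_Derive _ Hu); pose proof (smooth1_Derive _ Hv).
  pose proof (smooth1_Derive _ Hk).
  assert (k s ^ 3 <> 0) by (apply pow_nonzero, Rgt_not_eq, Hks).
  assert (k s ^ 2 <> 0) by (apply pow_nonzero, Rgt_not_eq, Hks).
  assert (k s <> 0) by (apply Rgt_not_eq, Hks).
  unfold bdry; auto_derive.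
  { repeat split; try (apply S; assumption); assumption. }
  eta_Derive; rewrite Ex, Ey; unfold EL_expr.
  assert (Ey2 : Derive y s ^ 2 = 1 - Derive x s ^ 2) by lra.
  generalize (Derive u s), (Derive v s), (Derive (Derive u) s), (Derive (Derive v) s),
    (Derive k s), (Derive (Derive k) s); intros u1 v1 u2 v2 k1 k2.
  revert Ey2 Hks; generalize (Derive x s), (Derive y s), (u s), (v s), (k s), (x s), (y s).
  intros x1 y1 u0 v0 k0 x0 y0 Ey2 Hks; field_simplify_eq; [|lra].
  ring [Ey2].
Qed.

Lemma is_derive_Acal_param (L : R) (V : R -> R -> R * R) :
  smooth_variation V ->
  let f := fun s t => fst (V s t) in
  let h := fun s t => snd (V s t) in
  is_derive (fun t => Acal L (slice V t)) 0
    (/ 2 * RInt (fun s =>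
       iterpd (false::nil) f s 0 * iterpd (true::nil) h s 0
       + f s 0 * iterpd (true::false::nil) h s 0
       - iterpd (true::false::nil) f s 0 * h s 0
       - iterpd (true::nil) f s 0 * iterpd (false::nil) h s 0) 0 (2 * L)).
Proof.
  intros [Sf Sh] f h; unfold Acal.
  pose (I := fun F l s t => iterpd l F s t).
  pose (b := true); pose (c := false).
  pose (G := fun t s => I f nil s t * I h (b::nil) s t - I f (b::nil) s t * I h nil s t).
  pose (dG := fun t s => I f (c::nil) s t * I h (b::nil) s t + I f nil s t * I h (c::b::nil) s t
                      - I f (c::b::nil) s t * I h nil s t - I f (b::nil) s t * I h (c::nil) s t).
  assert (Cf : forall l s t, continuity_2d_pt (I f l) s t) by (intros; apply smooth2_continuity, Sf).
  assert (Ch : forall l s t, continuity_2d_pt (I h l) s t) by (intros; apply smooth2_continuity, Sh).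
  assert (dGt : forall s t, is_derive (fun u => G u s) t (dG t s)).
  { intros s t.
    assert (Df : forall l, is_derive (fun u => I f l s u) t (I f (c::l) s t))
      by (intro l; exact (smooth2_is_derive_t f l s t Sf)).
    assert (Dh : forall l, is_derive (fun u => I h l s u) t (I h (c::l) s t))
      by (intro l; exact (smooth2_is_derive_t h l s t Sh)).
    replace (dG t s) with
      ((I f (c::nil) s t * I h (b::nil) s t + I f nil s t * I h (c::b::nil) s t)
       - (I f (c::b::nil) s t * I h nil s t + I f (b::nil) s t * I h (c::nil) s t))
      by (unfold dG; ring).
    apply (is_derive_minus (fun u => I f nil s u * I h (b::nil) s u)
                           (fun u => I f (b::nil) s u * I h nil s u));
      apply (is_derive_mult (fun u => I f _ s u) (fun u => I h _ s u)); auto;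
      intros; apply Rmult_comm. }
  apply (is_derive_scal (fun t => RInt (fun s => G t s) 0 (2 * L))).
  replace (RInt _ 0 (2 * L)) with (RInt (fun s => Derive (fun u => G u s) 0) 0 (2 * L)).
  - apply is_derive_RInt_param.
    + exists posreal_one; intros t _ s _; eexists; apply dGt.
    + intros s _; apply continuity_2d_pt_ext with (f := dG).
      { intros u w; symmetry; apply is_derive_unique, dGt. }
      apply continuity_2d_pt_swap with (f := fun s t => dG t s); unfold dG.
      repeat first [ apply Cf | apply Ch 
      | apply continuity_2d_pt_minus | apply continuity_2d_pt_plus
      | apply continuity_2d_pt_mult ].
    + exists posreal_one; intros t _; apply (ex_RInt_continuous (fun s => G t s)).
      intros s _; apply (smooth1_continuous (fun s => G t s)); unfold G.
      assert (Mf : forall l, smooth1 (fun s => I f l s t)) by (intro; apply smooth2_slice, Sf).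
      assert (Mh : forall l, smooth1 (fun s => I h l s t)) by (intro; apply smooth2_slice, Sh).
      apply (smooth1_minus (fun s => _) (fun s => _));
        apply (smooth1_mult (fun s => I f _ s t) (fun s => I h _ s t)); auto.
  - apply RInt_ext; intros s _; transitivity (dG 0 s).
    + apply is_derive_unique, dGt.
    + unfold dG, I, b, c.
      rewrite (smooth2_Schwarz f nil s 0 Sf), (smooth2_Schwarz h nil s 0 Sh); reflexivity.
Qed.

Lemma RInt_comb (f g h d : R -> R) (m a b : R) :
  a <= b ->
  (forall s, a <= s <= b -> continuous f s) -> (forall s, a <= s <= b -> continuous g s) ->
  (forall s, a <= s <= b -> continuous h s) ->
  (forall s, a <= s <= b -> d s = f s - m * g s - h s) ->
  RInt d a b = RInt f a b - m * RInt g a b - RInt h a b.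
Proof.
  intros Hab Cf Cg Ch E.
  assert (Ex : forall p : R -> R, (forall s, a <= s <= b -> continuous p s) -> ex_RInt p a b).
  { intros p Hp; apply (ex_RInt_continuous p); rewrite Rmin_left, Rmax_right; auto. }
  apply is_RInt_unique.
  apply (is_RInt_ext (fun s => f s - m * g s - h s)).
  { rewrite Rmin_left, Rmax_right by auto; intros s Hs; symmetry; apply E; lra. }
  apply (is_RInt_minus (fun s => f s - m * g s) h);
    [|apply (RInt_correct h); auto].
  apply (is_RInt_minus f (fun s => m * g s)); [apply (RInt_correct f); auto|].
  apply (is_RInt_scal g); apply (RInt_correct g); auto.
Qed.

Lemma ex_derive_div_pow (f k : R -> R) (n : nat) (s : R) :
  ex_derive f s -> ex_derive k s -> k s <> 0 -> ex_derive (fun s => f s / k s ^ n) s.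
Proof. intros; auto_derive; repeat split; auto; apply pow_nonzero; auto. Qed.

Lemma EL_expr_ex_derive (k : R -> R) (s : R) :
  smooth1 k -> 0 < k s -> ex_derive (EL_expr k) s.
Proof.
  intros Hk Hks; unfold EL_expr.
  pose proof (smooth1_Derive _ Hk) as Hk1; pose proof (smooth1_Derive _ Hk1) as Hk2.
  apply (ex_derive_plus (fun s => 2 - 2 * Derive (Derive k) s / k s ^ 3)
    (fun s => 6 * Derive k s ^ 2 / k s ^ 4));
    [apply (ex_derive_minus (fun _ => 2) (fun s => 2 * Derive (Derive k) s / k s ^ 3))|].
  - apply ex_derive_const.
  - apply (ex_derive_div_pow (fun s => 2 * Derive (Derive k) s)); [| |lra];
      apply smooth1_ex_derive; smooth1_tac.
  - apply (ex_derive_div_pow (fun s => 6 * Derive k s ^ 2)); [| |lra];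
      apply smooth1_ex_derive; smooth1_tac.
Qed.

Lemma first_variation (L lam : R) (V : R -> R -> R * R) :
  0 < L -> smooth_variation V ->
  let x := fun s => fst (V s 0) in
  let y := fun s => snd (V s 0) in
  let u := fun s => Derive (fun t => fst (V s t)) 0 in
  let v := fun s => Derive (fun t => snd (V s t)) 0 in
  let k := curv_num x y in
  unit_speed x y L -> (forall s, 0 <= s <= 2 * L -> 0 < k s) ->
  u 0 = 0 -> v 0 = 0 -> u (2 * L) = 0 -> v (2 * L) = 0 ->
  is_derive (fun t => Fcal L (slice V t) - lam * Acal L (slice V t)) 0
    (RInt (fun s => (lam - EL_expr k s) * (Derive x s * v s - Derive y s * u s)) 0 (2 * L)
     + (Derive x 0 * Derive v 0 - Derive y 0 * Derive u 0) / k 0 ^ 2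
     - (Derive x (2 * L) * Derive v (2 * L) - Derive y (2 * L) * Derive u (2 * L))
       / k (2 * L) ^ 2).
Proof.
  intros HL SV x y u v k U Hk u0 v0 u1 v1.
  pose proof SV as [Sf Sh].
  assert (Hx : smooth1 x) by exact (smooth2_slice _ nil 0 Sf).
  assert (Hy : smooth1 y) by exact (smooth2_slice _ nil 0 Sh).
  assert (Hu : smooth1 u) by exact (smooth2_slice _ (false :: nil) 0 Sf).
  assert (Hv : smooth1 v) by exact (smooth2_slice _ (false :: nil) 0 Sh).
  assert (Hks : smooth1 k) by (apply smooth1_curv_num; auto).
  pose proof (is_derive_Fcal_param L V HL SV Hk) as DF.
  pose proof (is_derive_Acal_param L V SV) as DA.
  cbv zeta in DF, DA.
  match type of DF with is_derive _ _ (RInt ?f _ _) => pose (f1 := f) end.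
  match type of DA with is_derive _ _ (_ * RInt ?f _ _) => pose (f2 := f) end.
  change (is_derive (fun t => Fcal L (slice V t)) 0 (RInt f1 0 (2 * L))) in DF.
  change (is_derive (fun t => Acal L (slice V t)) 0 (/ 2 * RInt f2 0 (2 * L))) in DA.
  set (f3 := fun s => (lam - EL_expr k s) * (Derive x s * v s - Derive y s * u s)).
  assert (E1 : forall s, 0 <= s <= 2 * L -> f1 s =
     4 * (Derive x s * Derive u s + Derive y s * Derive v s) / k s
     - (Derive u s * Derive (Derive y) s + Derive x s * Derive (Derive v) s
        - Derive v s * Derive (Derive x) s - Derive y s * Derive (Derive u) s) / k s ^ 2).
  { intros s Hs.
    transitivity (4 * (Derive x s ^ 2 + Derive y s ^ 2) 
         * (Derive x s * Derive u s + Derive y s * Derive v s) / k s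
       - (Derive x s ^ 2 + Derive y s ^ 2) ^ 2
         * (Derive u s * Derive (Derive y) s + Derive x s * Derive (Derive v) s
        - Derive v s * Derive (Derive x) s - Derive y s * Derive (Derive u) s) / k s ^ 2);
      [reflexivity|].
    rewrite (U s Hs); unfold Rdiv; ring. }
  assert (E2 : forall s, f2 s =
     u s * Derive y s + x s * Derive v s - Derive u s * y s - Derive x s * v s).
  { reflexivity. }
  assert (C1 : forall s, 0 <= s <= 2 * L -> continuous f1 s).
  { intros s Hs; apply (ex_derive_continuous f1).
    assert (Hk0 : k s <> 0) by (apply Rgt_not_eq, Hk, Hs).
    assert (ek : ex_derive k s) by (apply smooth1_ex_derive; exact Hks).
    apply (ex_derive_ext (fun s => 
       4 * (Derive x s ^ 2 + Derive y s ^ 2) 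
         * (Derive x s * Derive u s + Derive y s * Derive v s) / k s ^ 1
       - (Derive x s ^ 2 + Derive y s ^ 2) ^ 2
         * (Derive u s * Derive (Derive y) s + Derive x s * Derive (Derive v) s
        - Derive v s * Derive (Derive x) s - Derive y s * Derive (Derive u) s) / k s ^ 2)).
    { intro t; rewrite pow_1; reflexivity. }
    apply (ex_derive_minus (fun s => _ / k s ^ 1) (fun s => _ / k s ^ 2));
      apply (ex_derive_div_pow (fun s => _) k); auto; apply smooth1_ex_derive; smooth1_tac. }
  assert (C2 : forall s, 0 <= s <= 2 * L -> continuous f2 s).
  { intros s _; apply smooth1_continuous.
    apply (smooth1_minus (fun s => u s * Derive y s + x s * Derive v s - Derive u s * y s)
       (fun s => Derive x s * v s)); smooth1_tac. }
  assert (C3 : forall s, 0 <= s <= 2 * L -> continuous f3 s).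
  { intros s Hs; apply (ex_derive_continuous f3); unfold f3.
    apply ex_derive_mult.
    - apply (ex_derive_minus (fun _ => lam)); [apply ex_derive_const|].
      apply EL_expr_ex_derive; auto.
    - apply smooth1_ex_derive; smooth1_tac. }
  set (d := fun s => f1 s - lam / 2 * f2 s - f3 s).
  assert (Cd : forall s, 0 <= s <= 2 * L -> continuous d s).
  { intros s Hs; unfold d.
    apply (continuous_minus (fun s => f1 s - lam / 2 * f2 s) f3); [|auto].
    apply (continuous_minus f1 (fun s => lam / 2 * f2 s)); [auto|].
    apply (continuous_scal_r (lam / 2) f2); auto. }
  assert (R0 : Rmin 0 (2 * L) = 0) by (apply Rmin_left; lra).
  assert (R1 : Rmax 0 (2 * L) = 2 * L) by (apply Rmax_right; lra).
  assert (Ib : RInt d 0 (2 * L) = bdry x y u v k lam (2 * L) - bdry x y u v k lam 0).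
  { apply is_RInt_unique, (is_RInt_derive (bdry x y u v k lam)); rewrite R0, R1; [|exact Cd].
    intros s Hs; destruct (frenet x y L HL Hx Hy U s Hs) as [Ex Ey].
    replace (d s) with (4 * (Derive x s * Derive u s + Derive y s * Derive v s) / k s
     - (Derive u s * Derive (Derive y) s + Derive x s * Derive (Derive v) s
        - Derive v s * Derive (Derive x) s - Derive y s * Derive (Derive u) s) / k s ^ 2
     - lam / 2 * (u s * Derive y s + x s * Derive v s - Derive u s * y s - Derive x s * v s)
     - (lam - EL_expr k s) * (Derive x s * v s - Derive y s * u s)).
    - apply bdry_derive; auto.
    - unfold d, f3; rewrite E1, E2 by exact Hs; reflexivity. }
  rewrite (RInt_comb f1 f2 f3 d (lam / 2)) in Ib; auto; [|lra].
  (* The field vanishes at the fixed ends but its derivative need not: of [bdry] only the term in u'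
     and v' survives. *)
  assert (Eb : forall s, u s = 0 -> v s = 0 -> bdry x y u v k lam s
     = - (Derive x s * Derive v s - Derive y s * Derive u s) / k s ^ 2).
  { intros s Eu Ev; unfold bdry; rewrite Eu, Ev; unfold Rdiv; ring. }
  rewrite !Eb in Ib by assumption.
  replace (RInt f3 0 (2 * L) + _ - _) with (RInt f1 0 (2 * L) - lam * (/ 2 * RInt f2 0 (2 * L))).
  - apply (is_derive_minus (fun t => Fcal L (slice V t)) (fun t => lam * Acal L (slice V t)));
      [exact DF|].
    apply (is_derive_scal (fun t => Acal L (slice V t))); exact DA.
  - unfold Rdiv in *; lra.
Qed.

(** * Euler-Lagrange equation and natural boundary conditions *)

Lemma speed_pos_iff (g : curve) (s : R) :
  speed g s <> 0 <-> 0 < Derive (cx g) s ^ 2 + Derive (cy g) s ^ 2.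
Proof.
  unfold speed; split; intro H.
  - destruct (Rle_lt_dec (Derive (cx g) s ^ 2 + Derive (cy g) s ^ 2) 0) as [Hle|]; [|assumption].
    exfalso; apply H, sqrt_neg_0, Hle.
  - apply Rgt_not_eq, sqrt_lt_R0, H.
Qed.

Lemma curvature_pos_iff (g : curve) (s : R) :
  speed g s <> 0 -> (0 < curvature g s <-> 0 < curv_num (cx g) (cy g) s).
Proof.
  intro H.
  assert (Hp : 0 < speed g s ^ 3).
  { apply pow_lt; destruct (sqrt_pos (Derive (cx g) s ^ 2 + Derive (cy g) s ^ 2)) as [|E];
      [assumption | exfalso; apply H; symmetry; exact E]. }
  unfold curvature; fold (curv_num (cx g) (cy g) s); split; intro H1.
  - replace (curv_num (cx g) (cy g) s) with
      (curv_num (cx g) (cy g) s / speed g s ^ 3 * speed g s ^ 3) by (field; exact H).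
    apply Rmult_lt_0_compat; assumption.
  - apply Rdiv_lt_0_compat; assumption.
Qed.

Lemma arclength_unit_speed (L : R) (g : curve) :
  arclength_param L g -> unit_speed (cx g) (cy g) L.
Proof.
  intros H s Hs; specialize (H s Hs); unfold speed in H.
  rewrite <- (sqrt_sqrt (Derive (cx g) s ^ 2 + Derive (cy g) s ^ 2)) by nra.
  rewrite H; ring.
Qed.

Lemma unit_speed_arclength (L : R) (g : curve) :
  unit_speed (cx g) (cy g) L -> arclength_param L g.
Proof. intros H s Hs; unfold speed; rewrite (H s Hs); apply sqrt_1. Qed.

Lemma admissible_curv_num (x0 L : R) (g : curve) :
  admissible x0 L g -> forall s, 0 <= s <= 2 * L -> 0 < curv_num (cx g) (cy g) s.
Proof.
  intros (_ & Hr & Hc & _) s Hs; apply curvature_pos_iff; auto.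
Qed.

(* Horizontal variations: they leave y unchanged, so the constraint y > 0 is preserved and the area is affine in t. *)
Definition xvar (g : curve) (phi : R -> R) : R -> R -> R * R :=
  fun s t => (cx g s + t * phi s, cy g s).

Lemma xvar_0 (g : curve) (phi : R -> R) (s : R) : xvar g phi s 0 = g s.
Proof. unfold xvar, cx, cy; rewrite Rmult_0_l, Rplus_0_r; symmetry; apply surjective_pairing. Qed.

Lemma smooth_xvar (g : curve) (phi : R -> R) :
  smooth_curve g -> smooth1 phi -> smooth_variation (xvar g phi).
Proof.
  intros [Hx Hy] Hp; split; simpl; [apply smooth2_affine; assumption|].
  replace (fun s _ : R => cy g s) with (fun s t => cy g s + t * 0).
  - apply (smooth2_affine (cy g) (fun _ => 0)); [assumption | apply smooth1_const].
  - extensionality s; extensionality t; ring.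
Qed.

Lemma Derive_xvar (p phi : R -> R) (t : R) :
  smooth1 p -> smooth1 phi ->
  Derive (fun s => p s + t * phi s) = fun s => Derive p s + t * Derive phi s.
Proof.
  intros Hp Hphi; extensionality s; apply is_derive_unique.
  assert (ex_derive p s) by (apply smooth1_ex_derive; assumption).
  assert (ex_derive phi s) by (apply smooth1_ex_derive; assumption).
  auto_derive; [repeat split; assumption | eta_Derive; ring].
Qed.

(** Regularity, convexity and injectivity each give a radius in t by compactness. The other
    conditions hold for every t, since [phi] vanishes at the ends and y is untouched. *)
Lemma xvar_adm (x0 L : R) (g : curve) (phi : R -> R) :
  0 < L -> admissible x0 L g -> smooth1 phi -> phi 0 = 0 -> phi (2 * L) = 0 ->
  exists T, adm_variation x0 L g T (xvar g phi).
Proof.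
  intros HL Ad Hp p0 p1.
  pose proof Ad as ([Hx Hy] & Hr & Hc & Hinj & g0 & g1 & Hpos).
  pose proof (admissible_curv_num _ _ _ Ad) as HK.
  set (x := cx g) in *; set (y := cy g) in *.
  assert (C : forall p q : R -> R, smooth1 p -> smooth1 q ->
    forall s, continuity_2d_pt (fun s t => p s + t * q s) s 0).
  { intros p q Hp' Hq s; exact (smooth2_continuity _ nil s 0 (smooth2_affine p q Hp' Hq)). }
  assert (C0 : forall p : R -> R, smooth1 p -> forall s, continuity_2d_pt (fun s _ => p s) s 0).
  { intros p Hp' s; apply continuity_2d_of_smooth1; assumption. }
  assert (Hx1 : smooth1 (Derive x)) by smooth1_tac.
  assert (Hy1 : smooth1 (Derive y)) by smooth1_tac.
  assert (Hp1 : smooth1 (Derive phi)) by smooth1_tac.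
  assert (Hx2 : smooth1 (Derive (Derive x))) by smooth1_tac.
  assert (Hy2 : smooth1 (Derive (Derive y))) by smooth1_tac.
  assert (Hp2 : smooth1 (Derive (Derive phi))) by smooth1_tac.
  destruct (pos_near_segment (fun s t => (Derive x s + t * Derive phi s) ^ 2 + Derive y s ^ 2)
    0 (2 * L)) as [d1 D1].
  { intros s _; simpl; repeat first [apply continuity_2d_pt_plus | apply continuity_2d_pt_mult
      | apply continuity_2d_pt_const | apply continuity_2d_pt_id2 | apply C0; assumption]. }
  { intros s Hs; rewrite Rmult_0_l, Rplus_0_r; apply (speed_pos_iff g); auto. }
  destruct (pos_near_segment (fun s t => (Derive x s + t * Derive phi s) * Derive (Derive y) s
      - Derive y s * (Derive (Derive x) s + t * Derive (Derive phi) s)) 0 (2 * L)) as [d2 D2].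
  { intros s _; apply continuity_2d_pt_minus; apply continuity_2d_pt_mult;
      first [apply C0; assumption | apply C; assumption]. }
  { intros s Hs; rewrite !Rmult_0_l, !Rplus_0_r; apply HK, Hs. }
  destruct (injective_near_segment (fun s t => x s + t * phi s) (fun s _ => y s)
     (fun s t => Derive x s + t * Derive phi s) (fun s _ => Derive y s) 0 (2 * L)) as [d3 D3].
  { intros s t; 
    pose proof (equal_f (Derive_xvar x phi t Hx Hp) s) as E; simpl in E; rewrite <- E.
    apply smooth1_is_derive; smooth1_tac. }
  { intros s t; apply smooth1_is_derive, Hy. }
  { intro s; apply C; assumption. }
  { intro s; apply C0; assumption. }
  { intro s; apply C; assumption. }
  { intro s; apply C0; assumption. }
  { intros s Hs; rewrite Rmult_0_l, Rplus_0_r; pose proof (proj1 (speed_pos_iff g s) (Hr s Hs)) as P.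
    fold x y in P; destruct (Req_dec (Derive x s) 0) as [E|]; [right; intro E2|left; assumption].
    rewrite E, E2 in P; lra. }
  { intros s1 s2 H1 H2 E1 E2; rewrite !Rmult_0_l, !Rplus_0_r in E1; apply Hinj; auto.
    rewrite (surjective_pairing (g s1)), (surjective_pairing (g s2)).
    unfold x, y, cx, cy in E1, E2; rewrite E1, E2; reflexivity. }
  set (T := Rmin d1 (Rmin d2 d3) / 2).
  assert (HT : 0 < T /\ T < d1 /\ T < d2 /\ T < d3).
  { pose proof (cond_pos d1); pose proof (cond_pos d2); pose proof (cond_pos d3).
    unfold T, Rmin; repeat destruct Rle_dec; lra. }
  exists T; split; [lra|]; split; [apply smooth_xvar; [split|]; assumption|].
  split; [intros s _; apply xvar_0|]; intros t Ht.
  assert (Hta : Rabs t <= T) by (apply Rabs_le; lra).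
  assert (Ex : cx (slice (xvar g phi) t) = fun s => x s + t * phi s) by reflexivity.
  assert (Ey : cy (slice (xvar g phi) t) = y) by reflexivity.
  assert (Hreg : forall s, 0 <= s <= 2 * L -> speed (slice (xvar g phi) t) s <> 0).
  { intros s Hs; apply speed_pos_iff; rewrite Ex, Ey, Derive_xvar by assumption.
    apply D1; [assumption | lra]. }
  split; [|split; [|split; [|split; [|split; [|split]]]]].
  - split; [rewrite Ex; smooth1_tac | rewrite Ey; assumption].
  - exact Hreg.
  - intros s Hs; apply curvature_pos_iff; [auto|].
    rewrite Ex, Ey; unfold curv_num; rewrite Derive_xvar by assumption.
    rewrite Derive_xvar by assumption; apply D2; [assumption | lra].
  - intros s1 s2 H1 H2 E; apply (D3 s1 s2 t); auto; [lra | |].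
    + exact (f_equal fst E).
    + exact (f_equal snd E).
  - unfold slice, xvar; rewrite p0; unfold cx, cy; rewrite g0; simpl; f_equal; ring.
  - unfold slice, xvar; rewrite p1; unfold cx, cy; rewrite g1; simpl; f_equal; ring.
  - exact Hpos.
Qed.

Lemma Acal_xvar (x0 L : R) (g : curve) (phi : R -> R) (t : R) :
  admissible x0 L g -> smooth1 phi ->
  Acal L (slice (xvar g phi) t) = Acal L g + t * RInt (fun s => phi s * Derive (cy g) s) 0 (2 * L).
Proof.
  intros ([Hx Hy] & _ & _ & _ & g0 & g1 & _) Hp; unfold Acal.
  assert (y0 : cy g 0 = 0) by (unfold cy; rewrite g0; reflexivity).
  assert (y1 : cy g (2 * L) = 0) by (unfold cy; rewrite g1; reflexivity).
  change (cx (slice (xvar g phi) t)) with (fun s => cx g s + t * phi s).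
  change (cy (slice (xvar g phi) t)) with (cy g).
  rewrite Derive_xvar by assumption.
  set (x := cx g) in *; set (y := cy g) in *.
  assert (Ex : forall f : R -> R, smooth1 f -> is_RInt f 0 (2 * L) (RInt f 0 (2 * L))).
  { intros f Hf; apply (RInt_correct f), (ex_RInt_continuous f).
    intros s _; apply smooth1_continuous, Hf. }
  assert (I1 := Ex (fun s => x s * Derive y s - Derive x s * y s) ltac:(smooth1_tac)).
  assert (I2 := Ex (fun s => phi s * Derive y s) ltac:(smooth1_tac)).
  (* The integral of (phi y)' vanishes. Using it to replace - phi' y by phi y' doubles the term phi
     y' in the area, which cancels the factor 1/2. *)
  assert (I3 : is_RInt (fun s => Derive phi s * y s + phi s * Derive y s) 0 (2 * L) 0).
  { assert (E : 0 = phi (2 * L) * y (2 * L) - phi 0 * y 0) by (rewrite y0, y1; ring).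
    rewrite E at 2.
    apply (is_RInt_derive (fun s => phi s * y s)).
    - intros s _.
      assert (ex_derive phi s) by (apply smooth1_ex_derive; assumption).
      assert (ex_derive y s) by (apply smooth1_ex_derive; assumption).
      auto_derive; [repeat split; assumption | eta_Derive; ring].
    - intros s _; apply (smooth1_continuous (fun s => _)); smooth1_tac. }
  set (A := RInt (fun s => x s * Derive y s - Derive x s * y s) 0 (2 * L)) in *.
  set (B := RInt (fun s => phi s * Derive y s) 0 (2 * L)) in *.
  assert (I : is_RInt (fun s => (x s + t * phi s) * Derive y s
      - (Derive x s + t * Derive phi s) * y s) 0 (2 * L) (A + (2 * t) * B - t * 0)).
  { apply (is_RInt_ext (fun s => (x s * Derive y s - Derive x s * y s)
        + (2 * t) * (phi s * Derive y s) - t * (Derive phi s * y s + phi s * Derive y s))).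
    { intros s _; simpl; ring. }
    apply (is_RInt_minus (fun s => (x s * Derive y s - Derive x s * y s)
        + (2 * t) * (phi s * Derive y s)) (fun s => t * (Derive phi s * y s + phi s * Derive y s))).
    - apply (is_RInt_plus (fun s => x s * Derive y s - Derive x s * y s)
         (fun s => (2 * t) * (phi s * Derive y s))); [exact I1|].
      apply (is_RInt_scal (fun s => phi s * Derive y s)); exact I2.
    - apply (is_RInt_scal (fun s => Derive phi s * y s + phi s * Derive y s)); exact I3. }
  rewrite (is_RInt_unique _ _ _ _ I); field.
Qed.

Lemma xvar_derive (x0 L lam : R) (g : curve) (phi : R -> R) :
  0 < L -> admissible x0 L g -> arclength_param L g ->
  smooth1 phi -> phi 0 = 0 -> phi (2 * L) = 0 ->
  let k := curv_num (cx g) (cy g) in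
  is_derive (fun t => Fcal L (slice (xvar g phi) t) - lam * Acal L (slice (xvar g phi) t)) 0
    (RInt (fun s => (EL_expr k s - lam) * (Derive (cy g) s * phi s)) 0 (2 * L)
     - Derive (cy g) 0 * Derive phi 0 / k 0 ^ 2
     + Derive (cy g) (2 * L) * Derive phi (2 * L) / k (2 * L) ^ 2).
Proof.
  intros HL Ad Arc Hp p0 p1 k; pose proof Ad as ([Hx Hy] & _).
  pose proof (first_variation L lam (xvar g phi) HL (smooth_xvar g phi (conj Hx Hy) Hp)) as FV.
  cbv zeta in FV.
  replace (fun s => fst (xvar g phi s 0)) with (cx g) in FV
    by (extensionality s; rewrite xvar_0; reflexivity).
  replace (fun s => snd (xvar g phi s 0)) with (cy g) in FV
    by (extensionality s; rewrite xvar_0; reflexivity).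
  replace (fun s => Derive (fun t => fst (xvar g phi s t)) 0) with phi in FV.
  2:{ extensionality s; symmetry; apply is_derive_unique; unfold xvar; simpl.
      auto_derive; [auto | ring]. }
  replace (fun s => Derive (fun t => snd (xvar g phi s t)) 0) with (fun _ : R => 0) in FV.
  2:{ extensionality s; symmetry; unfold xvar; simpl; apply Derive_const. }
  assert (Ev : forall s, Derive (fun t => snd (xvar g phi s t)) 0 = 0).
  { intro s; unfold xvar; simpl; apply Derive_const. }
  assert (Eu : forall s, Derive (fun t => fst (xvar g phi s t)) 0 = phi s).
  { intro s; apply is_derive_unique; unfold xvar; simpl; auto_derive; [auto | ring]. }
  rewrite !Ev, !Eu in FV.
  specialize (FV (arclength_unit_speed L g Arc) (admissible_curv_num x0 L g Ad) p0 eq_refl p1 eq_refl).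
  fold k in FV.
  match type of FV with is_derive _ _ ?l => match goal with |- is_derive _ _ ?l' =>
    replace l' with l; [exact FV|] end end.
  rewrite !Derive_const.
  replace (RInt _ 0 (2 * L)) with
    (RInt (fun s => (EL_expr k s - lam) * (Derive (cy g) s * phi s)) 0 (2 * L)).
  - unfold Rdiv; ring.
  - apply RInt_ext; intros s _; rewrite Ev, Eu; simpl; ring.
Qed.

(** The area is affine in t with slope the integral of phi y', so orthogonality of phi to y' makes
    the variation exactly area-preserving. Then F and F - lam A have the same derivative, whatever
    [lam] is. *)
Lemma ap_critical_xvar (x0 L lam : R) (g : curve) (phi : R -> R) :
  0 < L -> ap_critical x0 L g -> arclength_param L g ->
  smooth1 phi -> phi 0 = 0 -> phi (2 * L) = 0 ->
  RInt (fun s => phi s * Derive (cy g) s) 0 (2 * L) = 0 ->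
  let k := curv_num (cx g) (cy g) in
  RInt (fun s => (EL_expr k s - lam) * (Derive (cy g) s * phi s)) 0 (2 * L)
     - Derive (cy g) 0 * Derive phi 0 / k 0 ^ 2
     + Derive (cy g) (2 * L) * Derive phi (2 * L) / k (2 * L) ^ 2 = 0.
Proof.
  intros HL (Ad & Cr & _) Arc Hp p0 p1 I k.
  destruct (xvar_adm x0 L g phi HL Ad Hp p0 p1) as [T HT].
  assert (EA : forall t, Acal L (slice (xvar g phi) t) = Acal L g).
  { intro t; rewrite (Acal_xvar x0), I by assumption; ring. }
  assert (D0 : is_derive (fun t => Fcal L (slice (xvar g phi) t)) 0 0).
  { apply (Cr T); [assumption|]; intros t _; rewrite !EA; reflexivity. }
  pose proof (xvar_derive x0 L lam g phi HL Ad Arc Hp p0 p1) as D1; cbv zeta in D1; fold k in D1.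
  assert (D2 : is_derive (fun t => Fcal L (slice (xvar g phi) t) - lam * Acal L (slice (xvar g phi) t)) 0 0).
  { apply (is_derive_ext (fun t => Fcal L (slice (xvar g phi) t) - lam * Acal L g));
      [intro t; rewrite EA; reflexivity|].
    replace 0 with (0 - 0) at 2 by ring.
    apply (is_derive_minus _ (fun _ => lam * Acal L g)); [exact D0 | apply (is_derive_const (lam * Acal L g))]. }
  apply is_derive_unique in D1; apply is_derive_unique in D2; congruence.
Qed.

Lemma smooth1_RInt_lin (f h : R -> R) (m a b : R) :
  smooth1 f -> smooth1 h ->
  RInt (fun s => f s + m * h s) a b = RInt f a b + m * RInt h a b.
Proof.
  intros Hf Hh; apply is_RInt_unique, (is_RInt_plus f (fun s => m * h s)).
  - apply (RInt_correct f), (ex_RInt_continuous f); intros s _; apply smooth1_continuous, Hf.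
  - apply (is_RInt_scal h), (RInt_correct h), (ex_RInt_continuous h).
    intros s _; apply smooth1_continuous, Hh.
Qed.

(** The double zeros at both ends make a field with this factor vanish there together with its
    derivative, so it contributes no boundary term; inside the interval the factor is positive. *)
Definition weight (L s : R) : R := (s * (2 * L - s)) ^ 2.

Lemma smooth1_weight (L : R) : smooth1 (weight L).
Proof. unfold weight; smooth1_tac. Qed.

Lemma weight_mult_ends (L : R) (q : R -> R) :
  smooth1 q -> forall s, s = 0 \/ s = 2 * L ->
  weight L s * q s = 0 /\ Derive (fun s => weight L s * q s) s = 0.
Proof.
  intros Hq s Hs.
  assert (E : s * (2 * L - s) = 0) by (destruct Hs; subst; ring).
  split; [unfold weight; rewrite E; ring|].
  assert (ex_derive q s) by (apply smooth1_ex_derive; assumption).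
  apply is_derive_unique; unfold weight; auto_derive; [repeat split; assumption|].
  eta_Derive; destruct Hs; subst s; ring.
Qed.

Lemma weight_pos (L s : R) : 0 < s < 2 * L -> 0 < weight L s.
Proof. intro H; unfold weight; apply pow_lt; nra. Qed.

Lemma weight_nonneg (L s : R) : 0 <= weight L s.
Proof. apply pow2_ge_0. Qed.

Lemma height_not_constant (x0 L : R) (g : curve) :
  0 < L -> admissible x0 L g ->
  ~ (forall s, 0 < s < 2 * L -> Derive (cy g) s = 0).
Proof.
  intros HL ([Hx Hy] & _ & _ & _ & g0 & _ & Hpos) H.
  destruct (smooth1_MVT (cy g) 0 L Hy HL) as (c & Hc & E).
  rewrite H in E by lra; specialize (Hpos L ltac:(lra)).
  unfold cy at 2 in E; rewrite g0 in E; simpl in E; lra.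
Qed.

Lemma euler_lagrange (x0 L : R) (g : curve) :
  0 < L -> ap_critical x0 L g -> arclength_param L g ->
  let k := curv_num (cx g) (cy g) in
  exists lam, (forall s, 0 <= s <= 2 * L -> EL_expr k s = lam) /\
    Derive (cy g) 0 = 0 /\ Derive (cy g) (2 * L) = 0 /\
    (forall lam', lam_critical x0 L lam' g -> lam' = lam).
Proof.
  intros HL Cr Arc k; pose proof Cr as (Ad & _); pose proof Ad as ([Hx Hy] & _).
  pose proof (admissible_curv_num x0 L g Ad) as Hk; fold k in Hk.
  assert (Sk : smooth1 k) by (apply smooth1_curv_num; assumption).
  pose proof (frenet (cx g) (cy g) L HL Hx Hy (arclength_unit_speed L g Arc)) as Fr; fold k in Fr.
  set (y := cy g) in *.
  (* The Euler-Lagrange expression times k^4. Clearing denominators keeps the test fields smooth on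
     the whole line, where k may vanish outside [0,2L]. *)
  pose (P := fun s => 2 * k s ^ 4 - 2 * Derive (Derive k) s * k s + 6 * Derive k s ^ 2).
  assert (SP : smooth1 P) by (unfold P; smooth1_tac).
  pose proof (smooth1_weight L) as SW.
  assert (EP : forall s, 0 <= s <= 2 * L -> EL_expr k s = P s / k s ^ 4).
  { intros s Hs; specialize (Hk s Hs); unfold EL_expr, P; field; lra. }
  pose (I1 := RInt (fun s => weight L s * (k s ^ 8 * Derive y s ^ 2)) 0 (2 * L)).
  pose (I0 := RInt (fun s => weight L s * (k s ^ 4 * P s * Derive y s ^ 2)) 0 (2 * L)).
  assert (Van : forall q, smooth1 q ->
     RInt (fun s => weight L s * (q s ^ 2 * Derive y s ^ 2)) 0 (2 * L) = 0 ->
     forall s, 0 < s < 2 * L -> q s = 0 \/ Derive y s = 0).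
  { intros q Sq I s Hs.
    assert (Z : weight L s * (q s ^ 2 * Derive y s ^ 2) = 0).
    { apply (RInt_nonneg_eq_0 (fun s => weight L s * (q s ^ 2 * Derive y s ^ 2)) 0 (2 * L));
        [lra | | | exact I | lra].
      - intro u; apply (smooth1_continuous (fun s => _)); smooth1_tac.
      - intros u _; pose proof (weight_nonneg L u).
        apply Rmult_le_pos; [assumption|]; apply Rmult_le_pos; apply pow2_ge_0. }
    pose proof (weight_pos L s Hs).
    assert (Z2 : (q s * Derive y s) ^ 2 = 0).
    { replace ((q s * Derive y s) ^ 2) with (q s ^ 2 * Derive y s ^ 2) by ring.
      apply Rmult_integral in Z; destruct Z; lra. }
    apply Rmult_integral; destruct (Req_dec (q s * Derive y s) 0) as [|N]; [assumption|].
    exfalso; exact (pow_nonzero _ 2 N Z2). }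
  assert (NI1 : I1 <> 0).
  { intro E; apply (height_not_constant x0 L g HL Ad); intros s Hs.
    destruct (Van (fun s => k s ^ 4)) with (s := s) as [Z|Z]; [smooth1_tac | | exact Hs | | exact Z].
    - transitivity I1; [|exact E]; apply RInt_ext_le; [lra|]; intros u _; ring.
    - exfalso; specialize (Hk s ltac:(lra)); apply (pow_nonzero (k s) 4); [lra | exact Z]. }
  (* The value for which the field [psi] below is orthogonal to y', hence area-preserving. *)
  pose (lam := I0 / I1).
  pose (q := fun s => P s - lam * k s ^ 4).
  assert (Sq : smooth1 q) by (unfold q; smooth1_tac).
  (* Since [EL_expr k] - [lam] = q/k^4 on [0,2L], this field turns the integrand of the first
     variation into the weighted square (q y')^2. *)
  pose (psi := fun s => weight L s * (k s ^ 4 * q s * Derive y s)).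
  assert (Spsi : smooth1 psi) by (unfold psi; smooth1_tac).
  assert (Ends : forall s, s = 0 \/ s = 2 * L -> psi s = 0 /\ Derive psi s = 0).
  { apply (weight_mult_ends L (fun s => k s ^ 4 * q s * Derive y s)); smooth1_tac. }
  destruct (Ends 0 (or_introl eq_refl)) as [psi0 psi0'].
  destruct (Ends (2 * L) (or_intror eq_refl)) as [psi1 psi1'].
  assert (Ipsi : RInt (fun s => psi s * Derive y s) 0 (2 * L) = 0).
  { transitivity (RInt (fun s => weight L s * (k s ^ 4 * P s * Derive y s ^ 2)
       + (- lam) * (weight L s * (k s ^ 8 * Derive y s ^ 2))) 0 (2 * L)).
    - apply RInt_ext_le; [lra|]; intros s _; unfold psi, q; ring.
    - rewrite (smooth1_RInt_lin (fun s => weight L s * (k s ^ 4 * P s * Derive y s ^ 2))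
        (fun s => weight L s * (k s ^ 8 * Derive y s ^ 2))) by smooth1_tac.
      fold I0 I1; unfold lam; eq_in_R; field; exact NI1. }
  pose proof (ap_critical_xvar x0 L lam g psi HL Cr Arc Spsi psi0 psi1 Ipsi) as Z.
  cbv zeta in Z; fold k y in Z; rewrite psi0', psi1' in Z.
  assert (Zq : RInt (fun s => weight L s * (q s ^ 2 * Derive y s ^ 2)) 0 (2 * L) = 0).
  { transitivity (RInt (fun s => (EL_expr k s - lam) * (Derive y s * psi s)) 0 (2 * L)).
    - apply RInt_ext_le; [lra|]; intros s Hs.
      specialize (Hk s ltac:(lra)); rewrite EP by lra; unfold psi, q; field; lra.
    - unfold Rdiv in Z; rewrite !Rmult_0_r, !Rmult_0_l, Rminus_0_r, Rplus_0_r in Z; exact Z. }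
  (* The product q y' vanishes. If q were nonzero at s, then y' would vanish near s, hence also y''
     = k x', and the tangent at s would be 0. *)
  assert (Hq0 : forall s, 0 < s < 2 * L -> q s = 0).
  { intros s Hs; destruct (Req_dec (q s) 0) as [|Hn]; [assumption|exfalso].
    destruct (continuous_ball q s (Rabs (q s))) as (d & Hd & Hb);
      [apply smooth1_continuous, Sq | apply Rabs_pos_lt, Hn |].
    assert (Y0 : forall u, Rabs (u - s) < Rmin d (Rmin s (2 * L - s)) -> Derive y u = 0).
    { intros u Hu.
      pose proof (Rmin_l d (Rmin s (2 * L - s))); pose proof (Rmin_r d (Rmin s (2 * L - s))).
      pose proof (Rmin_l s (2 * L - s)); pose proof (Rmin_r s (2 * L - s)).
      destruct (Van q Sq Zq u) as [Zu|Zu]; [|exfalso|exact Zu].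
      - apply Rabs_def2 in Hu; lra.
      - specialize (Hb u ltac:(lra)); rewrite Zu in Hb.
        rewrite Rminus_0_l, Rabs_Ropp in Hb; lra. }
    assert (Hp : 0 < Rmin d (Rmin s (2 * L - s))) by (repeat apply Rmin_pos; lra).
    assert (Y1 : Derive y s = 0) by (apply Y0; rewrite Rminus_eq_0, Rabs_R0; exact Hp).
    assert (Y2 : Derive (Derive y) s = 0).
    { rewrite <- (Derive_const 0 s); apply Derive_ext_loc; exists (mkposreal _ Hp).
      intros u Hu; apply Y0; exact Hu. }
    destruct (Fr s ltac:(lra)) as [_ F2]; specialize (Hk s ltac:(lra)).
    rewrite Y2 in F2; pose proof (arclength_unit_speed L g Arc s ltac:(lra)) as U.
    fold y in U; rewrite Y1 in U.
    symmetry in F2; apply Rmult_integral in F2; destruct F2 as [F2|F2]; [lra|].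
    rewrite F2 in U; lra. }
  assert (EL : forall s, 0 <= s <= 2 * L -> EL_expr k s = lam).
  { intros s Hs; rewrite EP by assumption; specialize (Hk s Hs).
    assert (Z1 : q s = 0).
    { apply (zero_on_closure q 0 (2 * L)); [lra | | exact Hq0 | exact Hs].
      intro u; apply smooth1_continuous, Sq. }
    unfold q in Z1; apply (Rmult_eq_reg_r (k s ^ 4)); [|apply pow_nonzero; lra].
    transitivity (P s); [field; lra | lra]. }
  assert (ZEL : forall phi lam', RInt (fun s => (EL_expr k s - lam') * (Derive y s * phi s)) 0 (2 * L)
     = RInt (fun s => (lam - lam') * (Derive y s * phi s)) 0 (2 * L)).
  { intros phi lam'; apply RInt_ext_le; [lra|]; intros s Hs.
    rewrite EL by lra; reflexivity. }
  (* Adding a multiple [mu] of a field with double zeros at the ends makes any [phi] area-preserving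
     without changing phi' at the ends. The interior term is 0 by now, so only the boundary terms
     remain. *)
  assert (Bd : forall phi, smooth1 phi -> phi 0 = 0 -> phi (2 * L) = 0 ->
     - Derive y 0 * Derive phi 0 / k 0 ^ 2
     + Derive y (2 * L) * Derive phi (2 * L) / k (2 * L) ^ 2 = 0).
  { intros phi Sphi p0 p1.
    pose (mu := - RInt (fun s => phi s * Derive y s) 0 (2 * L) / I1).
    pose (w := fun s => weight L s * (k s ^ 8 * Derive y s)).
    assert (Sw : smooth1 w) by (unfold w; smooth1_tac).
    assert (We : forall s, s = 0 \/ s = 2 * L -> w s = 0 /\ Derive w s = 0).
    { apply (weight_mult_ends L (fun s => k s ^ 8 * Derive y s)); smooth1_tac. }
    destruct (We 0 (or_introl eq_refl)) as [w0 w0'].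
    destruct (We (2 * L) (or_intror eq_refl)) as [w1 w1'].
    pose proof (ap_critical_xvar x0 L lam g (fun s => phi s + mu * w s) HL Cr Arc) as Z2.
    cbv zeta in Z2; fold k y in Z2.
    rewrite ZEL, Derive_xvar, w0', w1' in Z2 by assumption.
    assert (E0 : RInt (fun s => (lam - lam) * (Derive y s * (phi s + mu * w s))) 0 (2 * L) = 0).
    { transitivity (RInt (fun _ => 0) 0 (2 * L)).
      - apply RInt_ext_le; [lra|]; intros s _; ring.
      - apply RInt_zero. }
    rewrite E0 in Z2.
    assert (Z3 := Z2 ltac:(smooth1_tac) ltac:(rewrite p0, w0; ring) ltac:(rewrite p1, w1; ring)).
    rewrite !Rmult_0_r, !Rplus_0_r in Z3.
    assert (IZ : RInt (fun s => (phi s + mu * w s) * Derive y s) 0 (2 * L) = 0).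
    { transitivity (RInt (fun s => phi s * Derive y s
         + mu * (weight L s * (k s ^ 8 * Derive y s ^ 2))) 0 (2 * L)).
      - apply RInt_ext_le; [lra|]; intros s _; unfold w; ring.
      - rewrite (smooth1_RInt_lin (fun s => phi s * Derive y s)
          (fun s => weight L s * (k s ^ 8 * Derive y s ^ 2))) by smooth1_tac.
        fold I1; unfold mu; eq_in_R; field; exact NI1. }
    specialize (Z3 IZ); unfold Rdiv in *; rewrite Rminus_0_l in Z3; rewrite Ropp_mult_distr_l, Ropp_mult_distr_l in Z3; exact Z3. }
  exists lam; split; [exact EL|].
  assert (K0 : 0 < k 0 ^ 2) by (apply pow_lt, Hk; lra).
  assert (K1 : 0 < k (2 * L) ^ 2) by (apply pow_lt, Hk; lra).
  split; [|split].
  (* This cubic has a simple zero at 0 and a double one at 2L, so it isolates y'(0); its mirror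
     image isolates y'(2L) below. *)
  - pose proof (Bd (fun s => s * (2 * L - s) ^ 2) ltac:(smooth1_tac) ltac:(cbv beta; ring) ltac:(cbv beta; ring)) as B.
    replace (Derive (fun s => s * (2 * L - s) ^ 2) 0) with ((2 * L) ^ 2) in B
      by (symmetry; apply is_derive_unique; auto_derive; [auto | simpl; ring]).
    replace (Derive (fun s => s * (2 * L - s) ^ 2) (2 * L)) with 0 in B
      by (symmetry; apply is_derive_unique; auto_derive; [auto | simpl; ring]).
    assert (N : (2 * L) ^ 2 / k 0 ^ 2 <> 0) by (apply Rgt_not_eq, Rdiv_lt_0_compat; nra).
    apply (Rmult_eq_reg_r ((2 * L) ^ 2 / k 0 ^ 2)); [|exact N].
    unfold Rdiv in *; lra.
  - pose proof (Bd (fun s => s ^ 2 * (2 * L - s)) ltac:(smooth1_tac) ltac:(cbv beta; ring) ltac:(cbv beta; ring)) as B.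
    replace (Derive (fun s => s ^ 2 * (2 * L - s)) 0) with 0 in B
      by (symmetry; apply is_derive_unique; auto_derive; [auto | simpl; ring]).
    replace (Derive (fun s => s ^ 2 * (2 * L - s)) (2 * L)) with (- (2 * L) ^ 2) in B
      by (symmetry; apply is_derive_unique; auto_derive; [auto | simpl; ring]).
    assert (N : (2 * L) ^ 2 / k (2 * L) ^ 2 <> 0) by (apply Rgt_not_eq, Rdiv_lt_0_compat; nra).
    apply (Rmult_eq_reg_r ((2 * L) ^ 2 / k (2 * L) ^ 2)); [|exact N].
    unfold Rdiv in *; lra.
  (* A field that does change the area reads off the multiplier: its first variation is (lam - lam')
     times the nonzero integral [I1]. *)
  - intros lam' (_ & Cr' & _).
    pose (w := fun s => weight L s * (k s ^ 8 * Derive y s)).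
    assert (Sw : smooth1 w) by (unfold w; smooth1_tac).
    assert (We : forall s, s = 0 \/ s = 2 * L -> w s = 0 /\ Derive w s = 0).
    { apply (weight_mult_ends L (fun s => k s ^ 8 * Derive y s)); smooth1_tac. }
    destruct (We 0 (or_introl eq_refl)) as [w0 w0'].
    destruct (We (2 * L) (or_intror eq_refl)) as [w1 w1'].
    destruct (xvar_adm x0 L g w HL Ad Sw w0 w1) as [T HT].
    pose proof (Cr' T _ HT) as D1.
    pose proof (xvar_derive x0 L lam' g w HL Ad Arc Sw w0 w1) as D2.
    cbv zeta in D2; fold k y in D2; rewrite w0', w1', ZEL in D2.
    apply is_derive_unique in D1; apply is_derive_unique in D2; rewrite D1 in D2.
    assert (E : RInt (fun s => (lam - lam') * (Derive y s * w s)) 0 (2 * L) = (lam - lam') * I1).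
    { transitivity (RInt (fun s => 0 + (lam - lam') * (weight L s * (k s ^ 8 * Derive y s ^ 2))) 0 (2 * L)).
      - apply RInt_ext_le; [lra|]; intros s _; unfold w; ring.
      - rewrite (smooth1_RInt_lin (fun _ => 0) (fun s => weight L s * (k s ^ 8 * Derive y s ^ 2)))
          by smooth1_tac.
        fold I1; rewrite RInt_zero; eq_in_R; ring. }
    rewrite E in D2; unfold Rdiv in D2.
    assert (E3 : (lam - lam') * I1 = 0) by lra.
    apply Rmult_integral in E3; destruct E3; lra.
Qed.

(** * Integration of the Euler-Lagrange equation *)

Lemma is_derive_asin (x : R) : -1 < x < 1 -> is_derive asin x (/ cos (asin x)).
Proof.
  intro H; rewrite cos_asin by lra.
  apply is_derive_Reals.
  replace (/ sqrt (1 - x²)) with (derive_pt asin x (derivable_pt_asin x H)).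
  - apply (derive_pt_eq_1 asin x _ (derivable_pt_asin x H)); reflexivity.
  - rewrite derive_pt_asin; unfold Rdiv; apply Rmult_1_l.
Qed.

Lemma cos_asin_pos (x : R) : -1 < x < 1 -> 0 < cos (asin x).
Proof. intro H; destruct (asin_bound_lt x H); apply cos_gt_0; assumption. Qed.

Lemma cos_ne_1 (t : R) : 0 < t < 2 * PI -> cos t <> 1.
Proof.
  intros Ht E; replace t with (2 * (t / 2)) in E by field.
  rewrite cos_2a_sin in E.
  assert (0 < sin (t / 2)) by (apply sin_gt_0; lra). nra.
Qed.

(** With s - L = K sin a, the radius w sqrt(K^2 - (s-L)^2) is w K cos a. This is thus an
    antiderivative of the curvature, that is, the tangent angle up to a constant. *)
Lemma is_derive_scaled_asin (w K L s : R) :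
  0 < w -> 0 < L < K -> 0 <= s <= 2 * L ->
  is_derive (fun s => asin ((s - L) / K) / w) s (/ (w * (K * cos (asin ((s - L) / K))))).
Proof.
  intros Hw HK Hs.
  assert (B : -1 < (s - L) / K < 1).
  { split; [apply (Rmult_lt_reg_r K) | apply (Rmult_lt_reg_r K)]; try lra;
      unfold Rdiv; rewrite Rmult_assoc, Rinv_l; lra. }
  pose proof (cos_asin_pos _ B) as Hc.
  assert (D1 : is_derive (fun s => (s - L) / K) s (/ K)) by (auto_derive; [lra | field; lra]).
  pose proof (is_derive_comp asin (fun s => (s - L) / K) s _ _ (is_derive_asin _ B) D1) as D2.
  apply (is_derive_ext (fun s => / w * asin ((s - L) / K))); [intro t; apply Rmult_comm|].
  replace (/ (w * (K * cos (asin ((s - L) / K))))) with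
    (/ w * (/ K * / cos (asin ((s - L) / K)))) by (field; lra).
  apply (is_derive_scal (fun s => asin ((s - L) / K))); exact D2.
Qed.

(** A horizontal unit tangent has x' = 1 or x' = -1. In the second case y'' = k x' < 0, and y would
    be negative next to the end. *)
Lemma horizontal_ends (x0 L : R) (g : curve) :
  0 < L -> admissible x0 L g -> arclength_param L g ->
  Derive (cy g) 0 = 0 -> Derive (cy g) (2 * L) = 0 ->
  Derive (cx g) 0 = 1 /\ Derive (cx g) (2 * L) = 1.
Proof.
  intros HL Ad Arc Y0 Y1; pose proof Ad as ([Hx Hy] & _ & _ & _ & g0 & g1 & Hpos).
  pose proof (arclength_unit_speed L g Arc) as U.
  assert (Main : forall a, a = 0 \/ a = 2 * L -> cy g a = 0 -> Derive (cy g) a = 0 ->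
    Derive (cx g) a = 1).
  { intros a Ha ya Ya.
    assert (Ia : 0 <= a <= 2 * L) by lra.
    destruct (frenet (cx g) (cy g) L HL Hx Hy U a Ia) as [_ F2].
    pose proof (admissible_curv_num x0 L g Ad a Ia) as Hk.
    specialize (U a Ia); rewrite Ya in U.
    assert (E : (Derive (cx g) a - 1) * (Derive (cx g) a + 1) = 0) by lra.
    apply Rmult_integral in E; destruct E as [E|E]; [lra|exfalso].
    destruct (local_concave_negative (cy g) a Hy ya Ya) as (d & Hd & Neg).
    { rewrite F2; nra. }
    pose (e := Rmin d L / 2).
    assert (He : 0 < e < d /\ e < L) by (unfold e, Rmin; destruct Rle_dec; lra).
    destruct Ha; subst a.
    - specialize (Hpos e ltac:(lra)); specialize (Neg e ltac:(lra)).
      rewrite Rminus_0_r, Rabs_pos_eq in Neg by lra; lra.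
    - specialize (Hpos (2 * L - e) ltac:(lra)); specialize (Neg (2 * L - e) ltac:(lra)).
      replace (2 * L - e - 2 * L) with (- e) in Neg by ring.
      rewrite Rabs_Ropp, Rabs_pos_eq in Neg by lra; lra. }
  split; apply Main; auto; unfold cy; [rewrite g0 | rewrite g1]; reflexivity.
Qed.

(** The frequencies (pi + sigma)/sigma and (pi - sigma)/sigma are 1/w + 1 and 1/w - 1. The addition
    formulas regroup the two harmonics into products of functions of a and of a/w = th - pi, which
    is the form obtained by solving the first integrals for x and y. *)
Lemma gamma0_closed_form (x0 L : R) :
  0 < x0 -> 0 < L -> 3 * x0 < L ->
  let w := sqrt (x0 / (L + x0)) in
  let K := k0 x0 L in
  forall s, 0 <= s <= 2 * L ->
  let a := a0 x0 L s in
  let th := (a + PI * w) / w in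
  gamma0 x0 L s =
    ((w * (K * cos a) * sin th - w ^ 2 * (s - L) * cos th) / (1 - w ^ 2),
     (w * (K * cos (sigma0 x0 L)) - w * (K * cos a) * cos th - w ^ 2 * (s - L) * sin th) / (1 - w ^ 2)).
Proof.
  intros Hx0 HL H3 w K s Hs a th.
  assert (Hc : 0 < x0 / (L + x0)) by (apply Rdiv_lt_0_compat; lra).
  assert (Hw2 : w ^ 2 = x0 / (L + x0)) by (apply pow2_sqrt; lra).
  assert (Hc4 : x0 / (L + x0) < 1 / 4).
  { apply (Rmult_lt_reg_r (L + x0)); [lra|]; unfold Rdiv; rewrite Rmult_assoc, Rinv_l; lra. }
  assert (Hw : 0 < w) by (apply sqrt_lt_R0; exact Hc).
  assert (Hw1 : w < 1 / 2) by nra.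
  pose proof PI_RGT_0 as Hpi.
  assert (Hsig : sigma0 x0 L = PI * w) by reflexivity.
  assert (Hsin : 0 < sin (PI * w)) by (apply sin_gt_0; nra).
  assert (Hcos : 0 < cos (PI * w)) by (apply cos_gt_0; nra).
  assert (HK : K * sin (PI * w) = L) by (unfold K, k0; rewrite Hsig; field; lra).
  assert (HKL : L < K).
  { assert (sin (PI * w) < 1).
    { pose proof (sin2_cos2 (PI * w)) as S; unfold Rsqr in S; nra. }
    assert (0 < K) by (unfold K, k0; rewrite Hsig; apply Rdiv_lt_0_compat; lra). nra. }
  assert (Ha : K * sin a = s - L).
  { unfold a, a0; fold K; rewrite sin_asin; [field; lra|].
    split; apply (Rmult_le_reg_r K); try lra; unfold Rdiv; rewrite Rmult_assoc, Rinv_l; lra. }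
  unfold gamma0; fold K a; rewrite Hsig.
  replace ((PI + PI * w) / (PI * w) * a) with (a / w + a) by (field; lra).
  replace ((PI - PI * w) / (PI * w) * a) with (a / w - a) by (field; lra).
  replace th with (a / w + PI) by (unfold th; field; lra).
  rewrite neg_sin, neg_cos, sin_plus, sin_minus, cos_plus, cos_minus.
  (* With L = K sin sigma this identifies the additive constant of y: pi x0/(sigma tan sigma) = w K
     cos sigma/(1 - w^2). *)
  assert (Hx0w : x0 * (1 - w ^ 2) = w ^ 2 * L) by (rewrite Hw2; field; lra).
  assert (Hx0' : x0 = w ^ 2 * L / (1 - w ^ 2)) by (rewrite <- Hx0w; field; nra).
  rewrite <- Ha.
  f_equal.
  - field; repeat split; nra.
  - unfold tan; rewrite Hx0', <- HK. field; repeat split; nra.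
Qed.

Lemma critical_shape (x0 L lam : R) (g : curve) :
  0 < x0 -> 0 < L -> admissible x0 L g -> arclength_param L g ->
  (forall s, 0 <= s <= 2 * L -> EL_expr (curv_num (cx g) (cy g)) s = lam) ->
  Derive (cy g) 0 = 0 -> Derive (cy g) (2 * L) = 0 ->
  3 * x0 < L /\ lam = 2 * L / (L + x0) /\
  forall s, 0 <= s <= 2 * L -> g s = gamma0 x0 L s.
Proof.
  intros Hx0 HL Ad Arc EL Y0 Y1.
  pose proof Ad as ([Hx Hy] & _ & _ & _ & g0 & g1 & Hpos).
  destruct (horizontal_ends x0 L g HL Ad Arc Y0 Y1) as [X0 X1].
  pose proof (admissible_curv_num x0 L g Ad) as Hk.
  pose proof (arclength_unit_speed L g Arc) as U.
  pose proof (frenet (cx g) (cy g) L HL Hx Hy U) as Fr.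
  assert (Sk : smooth1 (curv_num (cx g) (cy g))) by (apply smooth1_curv_num; assumption).
  set (k := curv_num (cx g) (cy g)) in *.
  assert (x_0 : cx g 0 = x0) by (unfold cx; rewrite g0; reflexivity).
  assert (y_0 : cy g 0 = 0) by (unfold cy; rewrite g0; reflexivity).
  assert (x_1 : cx g (2 * L) = - x0) by (unfold cx; rewrite g1; reflexivity).
  assert (y_1 : cy g (2 * L) = 0) by (unfold cy; rewrite g1; reflexivity).
  set (x := cx g) in *; set (y := cy g) in *.
  pose (c := 1 - lam / 2).
  pose (r := fun s => / k s).
  (* This is r r', so that r' = rho k and the Euler-Lagrange equation becomes rho' = -c. *)
  pose (rho := fun s => - Derive k s / k s ^ 3).
  assert (Dk : forall s, ex_derive k s) by (intro; apply smooth1_ex_derive, Sk).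
  assert (Dk1 : forall s, ex_derive (Derive k) s)
    by (intro; apply smooth1_ex_derive, smooth1_Derive, Sk).
  assert (Dx1 : forall s, ex_derive (Derive x) s)
    by (intro; apply smooth1_ex_derive, smooth1_Derive, Hx).
  assert (Dy1 : forall s, ex_derive (Derive y) s)
    by (intro; apply smooth1_ex_derive, smooth1_Derive, Hy).
  assert (Dx : forall s, ex_derive x s) by (intro; apply smooth1_ex_derive, Hx).
  assert (Dy : forall s, ex_derive y s) by (intro; apply smooth1_ex_derive, Hy).
  assert (Dr : forall s, 0 <= s <= 2 * L -> is_derive r s (rho s * k s)).
  { intros s Hs; specialize (Hk s Hs); unfold r, rho.
    auto_derive; [repeat split; auto; lra | eta_Derive; field; lra]. }
  assert (Drho : forall s, 0 <= s <= 2 * L -> is_derive rho s (- c)).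
  { intros s Hs; specialize (Hk s Hs); unfold rho.
    assert (k s ^ 3 <> 0) by (apply pow_nonzero; lra).
    auto_derive; [repeat split; auto|]; eta_Derive.
    unfold c; rewrite <- (EL s Hs); unfold EL_expr; simpl; field; lra. }
  assert (I0 : 0 <= 0 <= 2 * L) by lra.
  assert (I1 : 0 <= 2 * L <= 2 * L) by lra.
  assert (rho_lin : forall s, 0 <= s <= 2 * L -> rho s = rho 0 - c * s).
  { intros s Hs.
    pose proof (eq_of_derive_eq rho (fun s => - c * s) (fun _ => - c) 0 (2 * L) Drho) as E.
    specialize (E ltac:(intros; auto_derive; [auto | ring]) s 0 Hs I0); simpl in E; lra. }
  (* two first integrals of the system x'' = -k y', y'' = k x', (r r')' = -c *)
  assert (FI1 : forall s, 0 <= s <= 2 * L ->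
    (1 - c) * x s - (r s * Derive y s + rho s * Derive x s) = (1 - c) * x0 - rho 0).
  { intros s Hs.
    pose proof (eq_of_derive_eq (fun s => (1 - c) * x s - (r s * Derive y s + rho s * Derive x s))
      (fun _ => 0) (fun _ => 0) 0 (2 * L)) as E.
    rewrite <- x_0; specialize (fun A => E A (fun s _ => is_derive_const 0 s) s 0 Hs I0).
    cbv beta in E; rewrite X0, Y0 in E.
    enough (forall s, 0 <= s <= 2 * L ->
      is_derive (fun s => (1 - c) * x s - (r s * Derive y s + rho s * Derive x s)) s 0) as D
      by (specialize (E D); lra).
    clear E s Hs; intros s Hs; destruct (Fr s Hs) as [F1 F2].
    pose proof (Dr s Hs) as Dr'; pose proof (Drho s Hs) as Drho'.
    assert (ex_derive r s) by (eexists; eauto). assert (ex_derive rho s) by (eexists; eauto).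
    auto_derive; [repeat split; auto|]; eta_Derive.
    rewrite (is_derive_unique _ _ _ Dr'), (is_derive_unique _ _ _ Drho'), F1, F2.
    unfold r; field; specialize (Hk s Hs); lra. }
  assert (FI2 : forall s, 0 <= s <= 2 * L ->
    (1 - c) * y s + (r s * Derive x s - rho s * Derive y s) = r 0).
  { intros s Hs.
    pose proof (eq_of_derive_eq (fun s => (1 - c) * y s + (r s * Derive x s - rho s * Derive y s))
      (fun _ => 0) (fun _ => 0) 0 (2 * L)) as E.
    specialize (fun A => E A (fun s _ => is_derive_const 0 s) s 0 Hs I0).
    cbv beta in E; rewrite X0, Y0, y_0 in E.
    enough (forall s, 0 <= s <= 2 * L ->
      is_derive (fun s => (1 - c) * y s + (r s * Derive x s - rho s * Derive y s)) s 0) as D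
      by (specialize (E D); lra).
    clear E s Hs; intros s Hs; destruct (Fr s Hs) as [F1 F2].
    pose proof (Dr s Hs) as Dr'; pose proof (Drho s Hs) as Drho'.
    assert (ex_derive r s) by (eexists; eauto). assert (ex_derive rho s) by (eexists; eauto).
    auto_derive; [repeat split; auto|]; eta_Derive.
    rewrite (is_derive_unique _ _ _ Dr'), (is_derive_unique _ _ _ Drho'), F1, F2.
    unfold r; field; specialize (Hk s Hs); lra. }
  assert (r_sq : forall s, 0 <= s <= 2 * L -> r s ^ 2 = r 0 ^ 2 + 2 * rho 0 * s - c * s ^ 2).
  { intros s Hs.
    pose proof (eq_of_derive_eq (fun s => r s ^ 2) (fun s => 2 * rho 0 * s - c * s ^ 2)
      (fun s => 2 * rho s) 0 (2 * L)) as E.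
    assert (D1 : forall s, 0 <= s <= 2 * L -> is_derive (fun s => r s ^ 2) s (2 * rho s)).
    { clear E s Hs; intros s Hs; pose proof (Dr s Hs) as Dr'.
      assert (ex_derive r s) by (eexists; eauto).
      auto_derive; [repeat split; auto|]; eta_Derive.
      rewrite (is_derive_unique _ _ _ Dr'); unfold r; field; specialize (Hk s Hs); lra. }
    assert (D2 : forall s, 0 <= s <= 2 * L ->
      is_derive (fun s => 2 * rho 0 * s - c * s ^ 2) s (2 * rho s)).
    { clear E s Hs D1; intros s Hs; rewrite (rho_lin s Hs); auto_derive; [auto | ring]. }
    specialize (E D1 D2 s 0 Hs I0); cbv beta in E.
    ring_simplify in E; ring_simplify; lra. }
  (* Between the two ends rho(0) cancels from the first integral, which leaves c L = (1 - c) x0. *)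
  assert (Hc : c = x0 / (L + x0)).
  { pose proof (FI1 (2 * L) I1) as E; rewrite X1, Y1, x_1, (rho_lin (2 * L) I1) in E.
    apply (Rmult_eq_reg_r (L + x0)); [|lra].
    unfold Rdiv; rewrite Rmult_assoc, Rinv_l; lra. }
  assert (Hr1 : r (2 * L) = r 0).
  { pose proof (FI2 (2 * L) I1) as E; rewrite X1, Y1, y_1 in E; lra. }
  assert (Hc0 : 0 < c) by (rewrite Hc; apply Rdiv_lt_0_compat; lra).
  assert (Hc1 : (1 - c) * (L + x0) = L) by (rewrite Hc; field; lra).
  (* Equal values of r at 0 and 2L place the vertex of the parabola r^2 at L. *)
  assert (Hrho0 : rho 0 = c * L).
  { pose proof (r_sq (2 * L) I1) as E; rewrite Hr1 in E.
    apply (Rmult_eq_reg_r L); [|lra]; lra. }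
  assert (rpos : forall s, 0 <= s <= 2 * L -> 0 < r s).
  { intros s Hs; apply Rinv_0_lt_compat, Hk, Hs. }
  pose (w := sqrt c).
  assert (Hw : 0 < w) by (apply sqrt_lt_R0, Hc0).
  assert (Hw2 : w ^ 2 = c) by (apply pow2_sqrt; lra).
  (* Completing the square: r(0)^2 + 2 c L s - c s^2 = c (K^2 - (s-L)^2). *)
  pose (K := sqrt (r 0 ^ 2 / c + L ^ 2)).
  assert (Hr0c : 0 < r 0 ^ 2 / c) by (apply Rdiv_lt_0_compat; [apply pow_lt, rpos, I0 | exact Hc0]).
  assert (HK2 : K ^ 2 = r 0 ^ 2 / c + L ^ 2).
  { apply pow2_sqrt; pose proof (pow2_ge_0 L); lra. }
  assert (HK0 : 0 <= K) by apply sqrt_pos.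
  assert (HKL : L < K) by nra.
  assert (r_sq' : forall s, 0 <= s <= 2 * L -> r s ^ 2 = c * (K ^ 2 - (s - L) ^ 2)).
  { intros s Hs; rewrite (r_sq s Hs), HK2, Hrho0; field; lra. }
  pose (a := fun s => asin ((s - L) / K)).
  assert (Bd : forall s, 0 <= s <= 2 * L -> -1 < (s - L) / K < 1).
  { intros s Hs; split; apply (Rmult_lt_reg_r K); try lra;
      unfold Rdiv; rewrite Rmult_assoc, Rinv_l; lra. }
  assert (sin_a : forall s, 0 <= s <= 2 * L -> K * sin (a s) = s - L).
  { intros s Hs; unfold a; rewrite sin_asin; [field; lra | pose proof (Bd s Hs); lra]. }
  assert (r_cos : forall s, 0 <= s <= 2 * L -> r s = w * (K * cos (a s))).
  { intros s Hs; pose proof (cos_asin_pos _ (Bd s Hs)) as Hcp; fold (a s) in Hcp.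
    pose proof (rpos s Hs).
    assert (E : r s ^ 2 = (w * (K * cos (a s))) ^ 2).
    { rewrite (r_sq' s Hs), <- (sin_a s Hs), <- Hw2.
      pose proof (sin2_cos2 (a s)) as S; unfold Rsqr in S.
      replace (cos (a s)) with (cos (a s) * 1) by ring.
      replace ((w * (K * (cos (a s) * 1))) ^ 2) with (w ^ 2 * K ^ 2 * (cos (a s) * cos (a s))) by ring.
      replace (cos (a s) * cos (a s)) with (1 - sin (a s) * sin (a s)) by lra; ring. }
    assert (0 < w * (K * cos (a s))) by (repeat apply Rmult_lt_0_compat; lra).
    nra. }
  pose (A := asin (L / K)).
  assert (BA : -1 < L / K < 1).
  { split; apply (Rmult_lt_reg_r K); try lra; unfold Rdiv; rewrite Rmult_assoc, Rinv_l; lra. }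
  assert (sin_A : K * sin A = L) by (unfold A; rewrite sin_asin by lra; field; lra).
  destruct (asin_bound_lt _ BA) as [A_lo A_hi]; fold A in A_lo, A_hi.
  pose proof PI_RGT_0 as Hpi.
  assert (A_pos : 0 < A).
  { destruct (Rlt_le_dec 0 A) as [|Hle]; [assumption|exfalso].
    assert (0 <= sin (- A)) by (apply sin_ge_0; lra). rewrite sin_neg in H; nra. }
  assert (a_0 : a 0 = - A).
  { unfold a, A; rewrite <- asin_opp; f_equal; field; lra. }
  assert (a_1 : a (2 * L) = A) by (unfold a, A; f_equal; field; lra).
  pose (th := fun s => (a s + A) / w).
  assert (Dth : forall s, 0 <= s <= 2 * L -> is_derive th s (k s)).
  { intros s Hs; replace (k s) with (/ (w * (K * cos (a s))) + 0).
    - apply (is_derive_ext (fun s => asin ((s - L) / K) / w + A / w)).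
      { intro t; unfold th, a; eq_in_R; field; lra. }
      apply (is_derive_plus (fun s => asin ((s - L) / K) / w) (fun _ => A / w));
        [apply is_derive_scaled_asin; lra | apply (is_derive_const (A / w))].
    - rewrite <- (r_cos s Hs); unfold r; rewrite Rinv_inv; ring. }
  assert (Rot : forall s, 0 <= s <= 2 * L -> Derive x s = cos (th s) /\ Derive y s = sin (th s)).
  { assert (th0 : th 0 = 0) by (unfold th; rewrite a_0; field; lra).
    (* In the frame turned by [th] both components of the tangent are constant, because th' = k.
       They keep their initial values 1 and 0, which identifies the tangent angle without choosing a
       lift. *)
    assert (R1 : forall s, 0 <= s <= 2 * L -> Derive x s * cos (th s) + Derive y s * sin (th s) = 1).
    { intros s Hs.
      pose proof (eq_of_derive_eq (fun s => Derive x s * cos (th s) + Derive y s * sin (th s))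
        (fun _ => 0) (fun _ => 0) 0 (2 * L)) as E.
      specialize (fun A => E A (fun s _ => is_derive_const 0 s) s 0 Hs I0).
      cbv beta in E; rewrite X0, Y0, th0, cos_0 in E.
      enough (forall s, 0 <= s <= 2 * L ->
        is_derive (fun s => Derive x s * cos (th s) + Derive y s * sin (th s)) s 0) as D
        by (specialize (E D); lra).
      clear E s Hs; intros s Hs; destruct (Fr s Hs) as [F1 F2]; pose proof (Dth s Hs) as D.
      assert (ex_derive th s) by (eexists; eauto).
      auto_derive; [repeat split; auto|]; eta_Derive.
      rewrite (is_derive_unique _ _ _ D), F1, F2; ring. }
    assert (R2 : forall s, 0 <= s <= 2 * L -> Derive y s * cos (th s) - Derive x s * sin (th s) = 0).
    { intros s Hs.
      pose proof (eq_of_derive_eq (fun s => Derive y s * cos (th s) - Derive x s * sin (th s))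
        (fun _ => 0) (fun _ => 0) 0 (2 * L)) as E.
      specialize (fun A => E A (fun s _ => is_derive_const 0 s) s 0 Hs I0).
      cbv beta in E; rewrite X0, Y0, th0, sin_0 in E.
      enough (forall s, 0 <= s <= 2 * L ->
        is_derive (fun s => Derive y s * cos (th s) - Derive x s * sin (th s)) s 0) as D
        by (specialize (E D); lra).
      clear E s Hs; intros s Hs; destruct (Fr s Hs) as [F1 F2]; pose proof (Dth s Hs) as D.
      assert (ex_derive th s) by (eexists; eauto).
      auto_derive; [repeat split; auto|]; eta_Derive.
      rewrite (is_derive_unique _ _ _ D), F1, F2; ring. }
    intros s Hs; specialize (R1 s Hs); specialize (R2 s Hs).
    pose proof (sin2_cos2 (th s)) as S; unfold Rsqr in S.
    set (C := cos (th s)) in *; set (Z := sin (th s)) in *.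
    split.
    - replace (Derive x s) with (Derive x s * (Z * Z + C * C)) by (rewrite S; ring).
      replace (Derive x s * (Z * Z + C * C)) with
        (C * (Derive x s * C + Derive y s * Z) - Z * (Derive y s * C - Derive x s * Z)) by ring.
      rewrite R1, R2; ring.
    - replace (Derive y s) with (Derive y s * (Z * Z + C * C)) by (rewrite S; ring).
      replace (Derive y s * (Z * Z + C * C)) with
        (Z * (Derive x s * C + Derive y s * Z) + C * (Derive y s * C - Derive x s * Z)) by ring.
      rewrite R1, R2; ring. }
  assert (HA : A = PI * w).
  { destruct (Rtotal_order A (PI * w)) as [Hlt|[Heq|Hgt]]; [exfalso|exact Heq|exfalso].
    (* The total turning 2A/w would lie strictly between 0 and 2 pi, but its cosine is x'(2L) =
       1. *)
    - destruct (Rot (2 * L) I1) as [C _]; rewrite X1 in C; symmetry in C.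
      revert C; apply cos_ne_1; unfold th; rewrite a_1; split.
      + apply Rdiv_lt_0_compat; lra.
      + apply (Rmult_lt_reg_r w); [exact Hw|]; unfold Rdiv; rewrite Rmult_assoc, Rinv_l; lra.
    - (* the tangent makes a full turn at an interior point s, where y would be negative *)
      pose (b := 2 * (PI * w) - A).
      assert (Hb : - A < b < A).
      { assert (0 < PI * w) by (apply Rmult_lt_0_compat; assumption). unfold b; lra. }
      assert (sb1 : sin b < sin A) by (apply sin_increasing_1; lra).
      assert (sb2 : sin (- A) < sin b) by (apply sin_increasing_1; lra).
      rewrite sin_neg in sb2.
      pose (s := L + K * sin b).
      assert (Hs : 0 < s < 2 * L) by (unfold s; split; nra).
      assert (as_ : a s = b).
      { unfold a, s; replace ((L + K * sin b - L) / K) with (sin b) by (field; lra).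
        apply asin_sin; lra. }
      assert (ths : th s = 2 * PI) by (unfold th; rewrite as_; unfold b; field; lra).
      destruct (Rot s ltac:(lra)) as [C S]; rewrite ths, cos_2PI in C; rewrite ths, sin_2PI in S.
      pose proof (FI2 s ltac:(lra)) as E; rewrite C, S in E.
      specialize (Hpos s Hs); fold y in Hpos.
      pose proof (r_sq' s ltac:(lra)) as Es; pose proof (r_sq' 0 I0) as E0.
      (* Since s is closer to L than the end 0 is, r is larger there. The tangent at s is (1, 0), so
         the second first integral reads (1-c) y(s) = r(0) - r(s) < 0. *)
      assert (r 0 < r s).
      { pose proof (rpos s ltac:(lra)); pose proof (rpos 0 I0).
        assert (r 0 ^ 2 < r s ^ 2) by (rewrite Es, E0; apply Rmult_lt_compat_l; nra). nra. }
      assert (0 < 1 - c) by nra. nra. }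
  assert (Hcw : w = sqrt (x0 / (L + x0))) by (unfold w; rewrite Hc; reflexivity).
  assert (Hsig : sigma0 x0 L = A) by (unfold sigma0; rewrite <- Hcw; symmetry; exact HA).
  (* From pi w = A < pi/2 one gets c = w^2 < 1/4, which is 4 x0 < L + x0. *)
  assert (H3 : 3 * x0 < L).
  { assert (w < 1 / 2) by nra. assert (c < 1 / 4) by nra.
    apply (Rmult_lt_compat_r (L + x0)) in H0; [|lra].
    rewrite Hc in H0; unfold Rdiv in H0; rewrite Rmult_assoc, Rinv_l in H0; lra. }
  split; [exact H3|]; split.
  { replace lam with (2 * (1 - c)) by (unfold c; field).
    apply (Rmult_eq_reg_r (L + x0)); [|lra].
    replace (2 * L / (L + x0) * (L + x0)) with (2 * L) by (field; lra); lra. }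
  intros s Hs.
  assert (HKk : k0 x0 L = K).
  { unfold k0; rewrite Hsig.
    transitivity (K * sin A / sin A); [rewrite sin_A; reflexivity | field].
    intro E; rewrite E in sin_A; lra. }
  rewrite (gamma0_closed_form x0 L Hx0 HL H3 s Hs); cbv zeta.
  rewrite <- Hcw, Hw2, HKk, Hsig, <- HA.
  assert (Ha0 : a0 x0 L s = a s) by (unfold a0; rewrite HKk; reflexivity).
  rewrite Ha0; fold (th s); rewrite <- (r_cos s Hs).
  assert (rA : w * (K * cos A) = r 0).
  { rewrite (r_cos 0 I0), a_0, cos_neg; reflexivity. }
  rewrite rA; destruct (Rot s Hs) as [<- <-].
  pose proof (FI1 s Hs) as E1; pose proof (FI2 s Hs) as E2.
  rewrite (rho_lin s Hs), Hrho0 in E1, E2.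
  assert (0 < 1 - c) by nra.
  rewrite (surjective_pairing (g s)); f_equal.
  - change (fst (g s)) with (x s); apply (Rmult_eq_reg_l (1 - c)); [|lra].
    transitivity (r s * Derive y s - c * (s - L) * Derive x s); [lra | field; lra].
  - change (snd (g s)) with (y s); apply (Rmult_eq_reg_l (1 - c)); [|lra].
    transitivity (r 0 - r s * Derive x s - c * (s - L) * Derive y s); [lra | field; lra].
Qed.

(** * Sufficiency of the Euler-Lagrange equation *)

Lemma Derive_nonneg_of_right_min (f : R -> R) (a T : R) :
  0 < T -> ex_derive f a -> (forall t, a <= t <= a + T -> f a <= f t) -> 0 <= Derive f a.
Proof.
  intros HT Hf Hmin; apply Derive_correct, is_derive_Reals in Hf.
  destruct (Rle_lt_dec 0 (Derive f a)) as [|Hlt]; [assumption|exfalso].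
  destruct (Hf (- Derive f a) ltac:(lra)) as [d Hd].
  pose (h := Rmin d T / 2).
  assert (Hh : 0 < h /\ h < d /\ h <= T).
  { pose proof (cond_pos d); unfold h, Rmin; destruct Rle_dec; lra. }
  specialize (Hd h ltac:(lra)); rewrite Rabs_pos_eq in Hd by lra; specialize (Hd ltac:(lra)).
  specialize (Hmin (a + h) ltac:(lra)).
  assert (0 <= (f (a + h) - f a) / h).
  { apply Rmult_le_pos; [lra | left; apply Rinv_0_lt_compat; lra]. }
  apply Rabs_def2 in Hd; lra.
Qed.

Lemma Derive_zero_of_right_const (f : R -> R) (a T : R) :
  0 < T -> ex_derive f a -> (forall t, a <= t <= a + T -> f t = f a) -> Derive f a = 0.
Proof.
  intros HT Hf Hc.
  assert (H1 : 0 <= Derive f a).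
  { apply (Derive_nonneg_of_right_min f a T HT Hf); intros t Ht; rewrite (Hc t Ht); lra. }
  assert (H2 : 0 <= Derive (fun t => - f t) a).
  { apply (Derive_nonneg_of_right_min (fun t => - f t) a T HT); [apply (ex_derive_opp f); exact Hf|].
    intros t Ht; rewrite (Hc t Ht); lra. }
  rewrite Derive_opp in H2; lra.
Qed.

Lemma Derive_comp_reflect (f : R -> R) (b s : R) :
  ex_derive f (b - s) -> Derive (fun s => f (b - s)) s = - Derive f (b - s).
Proof.
  intro H; apply is_derive_unique; auto_derive; [exact H|].
  change (Derive (fun x => f x) (b + - s)) with (Derive f (b - s)); ring.
Qed.

Lemma admissible_end_slopes (x0 L : R) (g : curve) :
  0 < L -> admissible x0 L g -> 0 <= Derive (cy g) 0 /\ Derive (cy g) (2 * L) <= 0.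
Proof.
  intros HL ([_ Hy] & _ & _ & _ & g0 & g1 & Hpos).
  assert (y0 : cy g 0 = 0) by (unfold cy; rewrite g0; reflexivity).
  assert (y1 : cy g (2 * L) = 0) by (unfold cy; rewrite g1; reflexivity).
  split.
  - apply (Derive_nonneg_of_right_min (cy g) 0 L HL); [apply smooth1_ex_derive, Hy|].
    intros t Ht; rewrite y0; destruct (Req_dec t 0) as [->|]; [lra|].
    left; apply Hpos; lra.
  - assert (H : 0 <= Derive (fun s => cy g (2 * L - s)) 0).
    { apply (Derive_nonneg_of_right_min (fun s => cy g (2 * L - s)) 0 L HL).
      - apply smooth1_ex_derive, (smooth1_comp (cy g)); [exact Hy | smooth1_tac].
      - intros t Ht; rewrite Rminus_0_r, y1; destruct (Req_dec t 0) as [->|];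
          [rewrite Rminus_0_r; lra|]. left; apply Hpos; lra. }
    rewrite Derive_comp_reflect in H by (apply smooth1_ex_derive, Hy).
    rewrite Rminus_0_r in H; lra.
Qed.

Lemma EL_expr_eq_on_interval (k1 k2 : R -> R) (a b : R) :
  a < b -> smooth1 k1 -> smooth1 k2 -> (forall s, a <= s <= b -> k1 s = k2 s) ->
  forall s, a <= s <= b -> EL_expr k1 s = EL_expr k2 s.
Proof.
  intros Hab H1 H2 E s Hs.
  assert (E1 := Derive_eq_on_interval k1 k2 a b Hab H1 H2 E).
  assert (E2 := Derive_eq_on_interval _ _ a b Hab (smooth1_Derive _ H1) (smooth1_Derive _ H2) E1).
  unfold EL_expr; rewrite E, E1, E2 by assumption; reflexivity.
Qed.

(** The Euler-Lagrange equation kills the interior term. With both end tangents equal to (1, 0) the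
    boundary term involves only v' at the ends, and exchanging s- and t-derivatives turns v' into
    the rate of change of the end slope, whose sign admissibility controls. *)
Lemma variation_derive (x0 L lam T : R) (g : curve) (V : R -> R -> R * R) :
  0 < L -> admissible x0 L g -> arclength_param L g ->
  (forall s, 0 <= s <= 2 * L -> EL_expr (curv_num (cx g) (cy g)) s = lam) ->
  Derive (cx g) 0 = 1 -> Derive (cy g) 0 = 0 ->
  Derive (cx g) (2 * L) = 1 -> Derive (cy g) (2 * L) = 0 ->
  adm_variation1 x0 L g T V ->
  let slope s t := Derive (cy (slice V t)) s in
  is_derive (fun t => Fcal L (slice V t) - lam * Acal L (slice V t)) 0
    (Derive (slope 0) 0 / curv_num (cx g) (cy g) 0 ^ 2
     - Derive (slope (2 * L)) 0 / curv_num (cx g) (cy g) (2 * L) ^ 2) /\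
  (forall s, ex_derive (slope s) 0) /\ slope 0 0 = 0 /\ slope (2 * L) 0 = 0.
Proof.
  intros HL Ad Arc EL X0 Y0 X1 Y1 (HT & SV & E0 & AdV) slope.
  pose proof Ad as ([Hx Hy] & _); pose proof SV as [Sf Sh].
  pose (x := fun s => fst (V s 0)); pose (y := fun s => snd (V s 0)).
  assert (Sx : smooth1 x) by exact (smooth2_slice _ nil 0 Sf).
  assert (Sy : smooth1 y) by exact (smooth2_slice _ nil 0 Sh).
  assert (H2L : 0 < 2 * L) by lra.
  assert (Ex : forall s, 0 <= s <= 2 * L -> x s = cx g s).
  { intros s Hs; unfold x, cx; rewrite E0 by assumption; reflexivity. }
  assert (Ey : forall s, 0 <= s <= 2 * L -> y s = cy g s).
  { intros s Hs; unfold y, cy; rewrite E0 by assumption; reflexivity. }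
  assert (Ex1 := Derive_eq_on_interval x (cx g) 0 (2 * L) H2L Sx Hx Ex).
  assert (Ey1 := Derive_eq_on_interval y (cy g) 0 (2 * L) H2L Sy Hy Ey).
  assert (Ex2 := Derive_eq_on_interval _ _ 0 (2 * L) H2L (smooth1_Derive _ Sx) (smooth1_Derive _ Hx) Ex1).
  assert (Ey2 := Derive_eq_on_interval _ _ 0 (2 * L) H2L (smooth1_Derive _ Sy) (smooth1_Derive _ Hy) Ey1).
  assert (Ek : forall s, 0 <= s <= 2 * L -> curv_num x y s = curv_num (cx g) (cy g) s).
  { intros s Hs; unfold curv_num; rewrite Ex1, Ey1, Ex2, Ey2 by assumption; reflexivity. }
  assert (I0 : 0 <= 0 <= 2 * L) by lra. assert (I1 : 0 <= 2 * L <= 2 * L) by lra.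
  (* The end points are fixed only for t in [0,T]. As V is smooth on both sides of t = 0, one-sided
     constancy already makes the two-sided derivative vanish. *)
  assert (Fix : forall s c, (forall t, 0 <= t <= T -> V s t = c) ->
    Derive (fun t => fst (V s t)) 0 = 0 /\ Derive (fun t => snd (V s t)) 0 = 0).
  { intros s c Hc; split; apply (Derive_zero_of_right_const _ 0 T HT).
    - eexists; exact (smooth2_is_derive_t _ nil s 0 Sf).
    - intros t Ht; rewrite !Hc by lra; reflexivity.
    - eexists; exact (smooth2_is_derive_t _ nil s 0 Sh).
    - intros t Ht; rewrite !Hc by lra; reflexivity. }
  destruct (Fix 0 (x0, 0)) as [u0 v0]; [intros t Ht; apply (AdV t Ht)|].
  destruct (Fix (2 * L) (- x0, 0)) as [u1 v1]; [intros t Ht; apply (AdV t Ht)|].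
  assert (Sw : forall s, Derive (fun s => Derive (fun t => snd (V s t)) 0) s = Derive (slope s) 0).
  { intro s; exact (smooth2_Schwarz _ nil s 0 Sh). }
  split; [|split; [|split]].
  - pose proof (first_variation L lam V HL SV) as FV; cbv zeta in FV.
    fold x y in FV.
    specialize (fun A B => FV A B u0 v0 u1 v1).
    match type of FV with _ -> _ -> is_derive _ _ ?l =>
      match goal with |- is_derive _ _ ?l' => replace l' with l; [apply FV|] end end.
    + intros s Hs; rewrite Ex1, Ey1 by assumption.
      exact (arclength_unit_speed L g Arc s Hs).
    + intros s Hs; rewrite Ek by assumption; exact (admissible_curv_num x0 L g Ad s Hs).
    + rewrite !Sw, Ex1, Ey1, Ex1, Ey1, !Ek, X0, Y0, X1, Y1 by assumption.
      rewrite (RInt_ext_le _ (fun _ => 0)), RInt_zero; [unfold Rdiv; ring | lra |].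
      intros s Hs.
      rewrite (EL_expr_eq_on_interval _ (curv_num (cx g) (cy g)) 0 (2 * L)), EL;
        [ring | assumption | assumption | apply smooth1_curv_num; assumption
        | apply smooth1_curv_num; assumption | assumption | assumption].
  - intro s; eexists; exact (smooth2_is_derive_t _ (true :: nil) s 0 Sh).
  - change (Derive y 0 = 0); rewrite Ey1; assumption.
  - change (Derive y (2 * L) = 0); rewrite Ey1; assumption.
Qed.

Lemma is_derive_right_deriv (f : R -> R) (l : R) :
  is_derive f 0 l -> filterlim (fun h => (f h - f 0) / h) (at_right 0) (locally l).
Proof.
  intros H P [e HP]; apply is_derive_Reals in H.
  destruct (H e (cond_pos e)) as [d Hd]; exists d; intros h Hh Hpos.
  apply HP; specialize (Hd h ltac:(lra)).
  change (Rabs (h - 0) < d) in Hh; rewrite Rminus_0_r in Hh; specialize (Hd Hh).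
  rewrite Rplus_0_l in Hd; exact Hd.
Qed.

Lemma adm_variation_one_sided (x0 L T : R) (g : curve) (V : R -> R -> R * R) :
  adm_variation x0 L g T V -> adm_variation1 x0 L g T V.
Proof.
  intros (HT & SV & E0 & Ad); repeat split; try apply SV; auto; apply Ad; lra.
Qed.

(* At the end points the slope of y can only increase, resp. decrease, along a one-sided variation; this gives the sign of the boundary terms. *)
Lemma lam_critical_of_EL (x0 L lam : R) (g : curve) :
  0 < L -> admissible x0 L g -> arclength_param L g ->
  (forall s, 0 <= s <= 2 * L -> EL_expr (curv_num (cx g) (cy g)) s = lam) ->
  Derive (cx g) 0 = 1 -> Derive (cy g) 0 = 0 ->
  Derive (cx g) (2 * L) = 1 -> Derive (cy g) (2 * L) = 0 ->
  lam_critical x0 L lam g.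
Proof.
  intros HL Ad Arc EL X0 Y0 X1 Y1.
  pose proof (admissible_curv_num x0 L g Ad) as Hk.
  assert (K0 : 0 < / curv_num (cx g) (cy g) 0 ^ 2).
  { apply Rinv_0_lt_compat, pow_lt, Hk; lra. }
  assert (K1 : 0 < / curv_num (cx g) (cy g) (2 * L) ^ 2).
  { apply Rinv_0_lt_compat, pow_lt, Hk; lra. }
  split; [exact Ad|]; split.
  - intros T V HV; pose proof (adm_variation_one_sided _ _ _ _ _ HV) as HV1.
    destruct (variation_derive x0 L lam T g V HL Ad Arc EL X0 Y0 X1 Y1 HV1) as (D & Dex & S0 & S1).
    destruct HV as (HT & _ & _ & AdV).
    (* For a two-sided variation the slope at s = 0 and minus the slope at s = 2L are minimal at the
       interior time t = 0, so both boundary terms vanish. *)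
    assert (Min : forall f : R -> R, ex_derive f 0 -> (forall t, - T <= t <= T -> f 0 <= f t) ->
      Derive f 0 = 0).
    { intros f Hf Hm.
      assert (H1 : 0 <= Derive f 0).
      { apply (Derive_nonneg_of_right_min f 0 T HT Hf); intros; apply Hm; lra. }
      assert (Hf' : ex_derive f (0 - 0)) by (rewrite Rminus_0_r; exact Hf).
      assert (H2 : 0 <= Derive (fun t => f (0 - t)) 0).
      { apply (Derive_nonneg_of_right_min (fun t => f (0 - t)) 0 T HT).
        - apply (ex_derive_comp f (fun t => 0 - t)); [exact Hf' | auto_derive; auto].
        - intros t Ht; rewrite Rminus_0_r; apply Hm; lra. }
      rewrite Derive_comp_reflect, Rminus_0_r in H2 by exact Hf'; lra. }
    rewrite (Min (fun t => Derive (cy (slice V t)) 0)) in D.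
    2: apply (Dex 0).
    2: { intros t Ht; rewrite S0; apply (admissible_end_slopes x0 L _ HL (AdV t Ht)). }
    replace (Derive (fun t => Derive (cy (slice V t)) (2 * L)) 0) with 0 in D.
    + replace (0 / _ - 0 / _) with 0 in D by (unfold Rdiv; ring); exact D.
    + assert (Z : Derive (fun t => - Derive (cy (slice V t)) (2 * L)) 0 = 0).
      { apply Min.
        - apply (ex_derive_opp (fun t => Derive (cy (slice V t)) (2 * L))), (Dex (2 * L)).
        - intros t Ht; rewrite S1; destruct (admissible_end_slopes x0 L _ HL (AdV t Ht)); lra. }
      rewrite Derive_opp in Z; lra.
  - intros T V HV.
    destruct (variation_derive x0 L lam T g V HL Ad Arc EL X0 Y0 X1 Y1 HV) as (D & Dex & S0 & S1).
    destruct HV as (HT & _ & _ & AdV).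
    eexists; split; [apply is_derive_right_deriv; exact D|].
    assert (H1 : 0 <= Derive (fun t => Derive (cy (slice V t)) 0) 0).
    { apply (Derive_nonneg_of_right_min _ 0 T HT (Dex 0)); intros t Ht; rewrite S0.
      apply (admissible_end_slopes x0 L _ HL (AdV t ltac:(lra))). }
    assert (H2 : 0 <= Derive (fun t => - Derive (cy (slice V t)) (2 * L)) 0).
    { apply (Derive_nonneg_of_right_min (fun t => - Derive (cy (slice V t)) (2 * L)) 0 T HT).
      - apply (ex_derive_opp (fun t => Derive (cy (slice V t)) (2 * L))), (Dex (2 * L)).
      - intros t Ht; rewrite S1; destruct (admissible_end_slopes x0 L _ HL (AdV t ltac:(lra))); lra. }
    rewrite Derive_opp in H2; unfold Rdiv; nra.
Qed.

Lemma lam_critical_ap_critical (x0 L lam : R) (g : curve) :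
  lam_critical x0 L lam g -> ap_critical x0 L g.
Proof.
  intros (Ad & C & C1); split; [exact Ad|]; split.
  - intros T V HV HA; pose proof (C T V HV) as D; destruct HV as (HT & _).
    apply (is_derive_ext_loc (fun t => Fcal L (slice V t) - lam * Acal L (slice V t)
      + lam * Acal L (slice V 0))).
    + exists (mkposreal T HT); intros t Ht.
      change (Rabs (t - 0) < T) in Ht; apply Rabs_def2 in Ht.
      rewrite (HA t) by lra; eq_in_R; ring.
    + replace 0 with (0 + 0) at 2 by ring.
      apply (is_derive_plus _ (fun _ => lam * Acal L (slice V 0))); [exact D|].
      apply (is_derive_const (lam * Acal L (slice V 0))).
  - intros T V HV HA; destruct (C1 T V HV) as (l & Hl & Hpos); destruct HV as (HT & _).
    exists l; split; [|exact Hpos].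
    apply (filterlim_ext_loc (fun h => ((Fcal L (slice V h) - lam * Acal L (slice V h))
      - (Fcal L (slice V 0) - lam * Acal L (slice V 0))) / h)); [|exact Hl].
    exists (mkposreal T HT); intros t Ht Hpt.
    change (Rabs (t - 0) < T) in Ht; apply Rabs_def2 in Ht.
    rewrite (HA t) by lra; f_equal; ring.
Qed.

(** * A smooth critical curve on the whole line *)

(** The powers of 1/z make the family closed under differentiation: the derivative of member n
    combines members n+1 and n+2. Smoothness of all members is then a single induction. *)
Definition flat (n : nat) (z : R) : R :=
  if Rlt_dec 0 z then (/ z) ^ n * exp (- / z) else 0.

Lemma flat_pos (n : nat) (z : R) : 0 < z -> flat n z = (/ z) ^ n * exp (- / z).
Proof. intro H; unfold flat; destruct (Rlt_dec 0 z); [reflexivity | contradiction]. Qed.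

Lemma flat_neg (n : nat) (z : R) : z <= 0 -> flat n z = 0.
Proof. intro H; unfold flat; destruct (Rlt_dec 0 z); [lra | reflexivity]. Qed.

Lemma pow_fact_le_exp (x : R) (n : nat) : 0 <= x -> x ^ n / INR (Factorial.fact n) <= exp x.
Proof.
  intro Hx; eapply Rle_trans; [|exact (exp_ge_taylor x n Hx)].
  assert (T : forall k, 0 <= x ^ k / INR (Factorial.fact k)).
  { intro k; apply Rmult_le_pos; [apply pow_le; exact Hx|].
    left; apply Rinv_0_lt_compat, INR_fact_lt_0. }
  destruct n as [|n]; [simpl; lra|]; rewrite tech5.
  assert (0 <= sum_f_R0 (fun k => x ^ k / INR (Factorial.fact k)) n) by (apply cond_pos_sum; exact T).
  lra.
Qed.

(** One Taylor term, exp(1/z) >= (1/z)^(n+2)/(n+2)!, beats the factor (1/z)^n and leaves z^2. A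
    quadratic bound is what gives derivative 0 at the origin. *)
Lemma flat_le (n : nat) (z : R) : Rabs (flat n z) <= INR (Factorial.fact (n + 2)) * z ^ 2.
Proof.
  pose proof (INR_fact_lt_0 (n + 2)) as Hf.
  destruct (Rlt_le_dec 0 z) as [Hz|Hz].
  - rewrite flat_pos by exact Hz.
    assert (Hi : 0 < / z) by (apply Rinv_0_lt_compat; exact Hz).
    pose proof (pow_lt (/ z) n Hi) as Hp.
    rewrite Rabs_pos_eq by (apply Rmult_le_pos; [lra | left; apply exp_pos]).
    pose proof (pow_fact_le_exp (/ z) (n + 2) ltac:(lra)) as E.
    rewrite exp_Ropp; pose proof (exp_pos (/ z)) as He.
    apply (Rmult_le_reg_r (exp (/ z))); [exact He|].
    rewrite Rmult_assoc, Rinv_l by lra.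
    apply Rle_trans with (INR (Factorial.fact (n + 2)) * z ^ 2 * ((/ z) ^ (n + 2) / INR (Factorial.fact (n + 2)))).
    + right; rewrite pow_add; field; lra.
    + apply Rmult_le_compat_l; [|exact E]; apply Rmult_le_pos; [lra | apply pow2_ge_0].
  - rewrite flat_neg, Rabs_R0 by exact Hz; apply Rmult_le_pos; [lra | apply pow2_ge_0].
Qed.

Lemma is_derive_flat (n : nat) (z : R) :
  is_derive (flat n) z (flat (n + 2) z - INR n * flat (n + 1) z).
Proof.
  destruct (Rtotal_order z 0) as [Hz|[->|Hz]].
  - rewrite !flat_neg by lra; replace (0 - INR n * 0) with 0 by ring.
    apply (is_derive_ext_loc (fun _ => 0)); [|apply (is_derive_const 0)].
    exists (mkposreal (- z) ltac:(lra)); intros u Hu.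
    change (Rabs (u - z) < - z) in Hu; apply Rabs_def2 in Hu.
    rewrite flat_neg by lra; reflexivity.
  - rewrite !flat_neg by lra; replace (0 - INR n * 0) with 0 by ring.
    apply is_derive_Reals; intros eps Heps.
    pose proof (INR_fact_lt_0 (n + 2)) as Hf.
    assert (Hd : 0 < eps / INR (Factorial.fact (n + 2))) by (apply Rdiv_lt_0_compat; lra).
    exists (mkposreal _ Hd); intros h Hh Hlt; simpl in Hlt.
    rewrite Rplus_0_l, (flat_neg n 0), !Rminus_0_r by lra.
    unfold Rdiv; rewrite Rabs_mult, Rabs_inv.
    pose proof (Rabs_pos_lt h Hh) as Hah.
    apply Rle_lt_trans with (INR (Factorial.fact (n + 2)) * Rabs h).
    + apply (Rmult_le_reg_r (Rabs h)); [exact Hah|].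
      rewrite Rmult_assoc, Rinv_l, Rmult_1_r by lra.
      eapply Rle_trans; [apply flat_le|]; rewrite <- pow2_abs; right; ring.
    + apply (Rmult_lt_reg_l (/ INR (Factorial.fact (n + 2)))); [apply Rinv_0_lt_compat; lra|].
      rewrite <- Rmult_assoc, Rinv_l, Rmult_1_l by lra.
      rewrite Rmult_comm; exact Hlt.
  - rewrite !flat_pos by exact Hz.
    apply (is_derive_ext_loc (fun z => (/ z) ^ n * exp (- / z))).
    { exists (mkposreal z Hz); intros u Hu.
      change (Rabs (u - z) < z) in Hu; apply Rabs_def2 in Hu.
      rewrite flat_pos by lra; reflexivity. }
    auto_derive; [repeat split; lra|].
    rewrite !pow_add; destruct n as [|n]; [simpl; field; lra|].
    rewrite S_INR; simpl pred; simpl pow; field; lra.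
Qed.

Lemma smooth1_flat (n : nat) : smooth1 (flat n).
Proof.
  apply smooth1_Cn; intro m; revert n; induction m as [|m IH]; intro n; [exact I|]; split.
  - intro s; eexists; apply is_derive_flat.
  - replace (Derive (flat n)) with (fun z => flat (n + 2) z + (- INR n) * flat (n + 1) z).
    + apply Cn_plus; [apply IH | apply Cn_mult; [apply Cn_const | apply IH]].
    + extensionality z; symmetry; apply is_derive_unique.
      replace (flat (n + 2) z + - INR n * flat (n + 1) z)
        with (flat (n + 2) z - INR n * flat (n + 1) z) by ring.
      apply is_derive_flat.
Qed.

Lemma flat_ge_0 (z : R) : 0 <= flat 0 z.
Proof.
  destruct (Rlt_le_dec 0 z); [rewrite flat_pos | rewrite flat_neg]; try lra.
  simpl; rewrite Rmult_1_l; left; apply exp_pos.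
Qed.

Lemma flat_increasing (z1 z2 : R) : 0 < z1 <= z2 -> flat 0 z1 <= flat 0 z2.
Proof.
  intros [H1 H2]; rewrite !flat_pos by lra; simpl; rewrite !Rmult_1_l.
  assert (/ z2 <= / z1) by (apply Rinv_le_contravar; lra).
  destruct (Req_dec (/ z1) (/ z2)) as [->|]; [lra|].
  left; apply exp_increasing; lra.
Qed.

Lemma positive_smooth_extension (L K : R) :
  0 < L < K ->
  exists m : R -> R, smooth1 m /\ (forall s, 0 < m s) /\
    (forall s, 0 <= s <= 2 * L -> m s = K ^ 2 - (s - L) ^ 2).
Proof.
  intros HL.
  assert (HKL : 0 < K ^ 2 - L ^ 2) by nra.
  assert (Hb : 0 < flat 0 (K ^ 2 - L ^ 2)).
  { rewrite flat_pos by exact HKL; simpl; rewrite Rmult_1_l; apply exp_pos. }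
  remember (flat 0 (K ^ 2 - L ^ 2)) as beta eqn:Ebeta.
  (* Put q = (s-L)^2. The correction vanishes for q <= L^2, that is on [0,2L], and is nonnegative.
     For q >= K^2 monotonicity of [flat 0] and the choice of [beta] make it at least q, so the sum
     is at least K^2. *)
  exists (fun s => K ^ 2 - (s - L) ^ 2 + (s - L) ^ 2 * / beta * flat 0 ((s - L) ^ 2 - L ^ 2)).
  split; [|split].
  - assert (smooth1 (fun s => flat 0 ((s - L) ^ 2 - L ^ 2))).
    { apply (smooth1_comp (flat 0) (fun s => (s - L) ^ 2 - L ^ 2)); [apply smooth1_flat | smooth1_tac]. }
    smooth1_tac.
  - intro s; set (q := (s - L) ^ 2).
    assert (Hq : 0 <= q) by apply pow2_ge_0.
    pose proof (flat_ge_0 (q - L ^ 2)) as Hf.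
    assert (Hib : 0 < / beta) by (apply Rinv_0_lt_compat; exact Hb).
    destruct (Rlt_le_dec q (K ^ 2)) as [H|H].
    + assert (0 <= q * / beta * flat 0 (q - L ^ 2)) by (apply Rmult_le_pos; [apply Rmult_le_pos|]; lra). lra.
    + assert (beta <= flat 0 (q - L ^ 2)) by (rewrite Ebeta; apply flat_increasing; lra).
      assert (1 <= / beta * flat 0 (q - L ^ 2)).
      { apply (Rmult_le_reg_l beta); [exact Hb|].
        rewrite <- Rmult_assoc, Rinv_r, Rmult_1_l, Rmult_1_r; [assumption | apply Rgt_not_eq, Hb]. }
      rewrite Rmult_assoc; nra.
  - intros s Hs; rewrite flat_neg by nra; ring.
Qed.

Lemma is_derive_inv_sqrt (m : R -> R) (s : R) :
  smooth1 m -> 0 < m s ->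
  is_derive (fun s => / sqrt (m s)) s (- / 2 * (/ sqrt (m s)) ^ 3 * Derive m s).
Proof.
  intros Hm Hp; assert (ex_derive m s) by (apply smooth1_ex_derive; assumption).
  pose proof (sqrt_lt_R0 _ Hp).
  auto_derive; [repeat split; auto; lra|]; eta_Derive; field; lra.
Qed.

(** The derivative of p = m^(-1/2) is -p^3 m'/2, a polynomial in p and m', so the order of
    differentiability can be raised step by step. *)
Lemma smooth1_inv_sqrt (m : R -> R) :
  smooth1 m -> (forall s, 0 < m s) -> smooth1 (fun s => / sqrt (m s)).
Proof.
  intros Hm Hp; apply smooth1_Cn; intro n; induction n as [|n IH]; [exact I|]; split.
  - intro s; eexists; apply is_derive_inv_sqrt; auto.
  - replace (Derive (fun s => / sqrt (m s)))
      with (fun s => - / 2 * ((/ sqrt (m s)) * ((/ sqrt (m s)) * (/ sqrt (m s)))) * Derive m s).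
    + assert (Cn n (Derive m)) by (apply smooth1_Cn, smooth1_Derive, Hm).
      apply (Cn_mult n (fun s => - / 2 * _)); [|assumption].
      repeat apply (Cn_mult n); auto; apply Cn_const.
    + extensionality s; symmetry; apply is_derive_unique.
      replace (- / 2 * (/ sqrt (m s) * (/ sqrt (m s) * / sqrt (m s))) * Derive m s)
        with (- / 2 * (/ sqrt (m s)) ^ 3 * Derive m s) by ring.
      apply is_derive_inv_sqrt; auto.
Qed.

Lemma is_derive_RInt_smooth (p : R -> R) (a s : R) :
  smooth1 p -> is_derive (fun s => RInt p a s) s (p s).
Proof.
  intro Hp; apply (is_derive_RInt p _ a).
  - exists posreal_one; intros u _; apply (RInt_correct p), (ex_RInt_continuous p).
    intros; apply smooth1_continuous, Hp.
  - apply smooth1_continuous, Hp.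
Qed.

Lemma radius_and_angle (w K L : R) :
  0 < w -> 0 < L < K ->
  exists r th : R -> R, smooth1 r /\ smooth1 th /\
    (forall s, 0 < r s) /\ (forall s, is_derive th s (/ r s)) /\
    (forall s, 0 <= s <= 2 * L -> r s ^ 2 = w ^ 2 * (K ^ 2 - (s - L) ^ 2)) /\
    (forall s, 0 <= s <= 2 * L -> th s = PI + asin ((s - L) / K) / w).
Proof.
  intros Hw HL.
  destruct (positive_smooth_extension L K HL) as (m & Sm & Pm & Em).
  pose (p := fun s => / sqrt (m s)).
  assert (Sp : smooth1 p) by (apply smooth1_inv_sqrt; assumption).
  (* This is w sqrt m, written through p = 1/sqrt m so that its smoothness follows from that of
     p. *)
  pose (r := fun s => w * (m s * p s)).
  assert (Er : forall s, r s = w * sqrt (m s)).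
  { intro s; pose proof (sqrt_lt_R0 _ (Pm s)) as H.
    unfold r, p; rewrite <- (sqrt_sqrt (m s)) at 1 by (left; apply Pm); field; lra. }
  assert (Pr : forall s, 0 < r s).
  { intro s; rewrite Er; apply Rmult_lt_0_compat; [exact Hw | apply sqrt_lt_R0, Pm]. }
  assert (Er2 : forall s, 0 <= s <= 2 * L -> r s ^ 2 = w ^ 2 * (K ^ 2 - (s - L) ^ 2)).
  { intros s Hs; rewrite Er, Rpow_mult_distr, pow2_sqrt, Em by (try (left; apply Pm); assumption).
    reflexivity. }
  (* The base point is the midpoint L, where the tangent of the symmetric curve is (-1, 0) and the
     arcsine vanishes. *)
  pose (th := fun s => PI + / w * RInt p L s).
  assert (Dth : forall s, is_derive th s (/ r s)).
  { intro s; replace (/ r s) with (0 + / w * p s).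
    - apply (is_derive_plus (fun _ => PI) (fun s => / w * RInt p L s)); [apply (is_derive_const PI)|].
      apply (is_derive_scal (fun s => RInt p L s)), is_derive_RInt_smooth, Sp.
    - rewrite Er; unfold p; pose proof (sqrt_lt_R0 _ (Pm s)); eq_in_R; field; lra. }
  assert (Sk : smooth1 (fun s => / r s)).
  { replace (fun s => / r s) with (fun s => / w * p s); [smooth1_tac|].
    extensionality s; rewrite Er; unfold p; pose proof (sqrt_lt_R0 _ (Pm s)); field; lra. }
  exists r, th; split; [unfold r; smooth1_tac|].
  split; [exact (smooth1_of_derive th _ Dth Sk)|].
  do 3 (split; [assumption|]).
  intros s Hs.
  assert (D2 : forall s, 0 <= s <= 2 * L ->
    is_derive (fun s => asin ((s - L) / K) / w) s (/ r s)).
  { clear s Hs; intros s Hs; replace (r s) with (w * (K * cos (asin ((s - L) / K)))).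
    - apply is_derive_scaled_asin; assumption.
    - assert (B : -1 < (s - L) / K < 1).
      { split; apply (Rmult_lt_reg_r K); try lra;
          unfold Rdiv; rewrite Rmult_assoc, Rinv_l; lra. }
      pose proof (cos_asin_pos _ B) as Hc; pose proof (Pr s) as Hr.
      assert (E : r s ^ 2 = (w * (K * cos (asin ((s - L) / K)))) ^ 2).
      { rewrite (Er2 s Hs).
        replace ((w * (K * cos (asin ((s - L) / K)))) ^ 2)
          with (w ^ 2 * (K ^ 2 * (cos (asin ((s - L) / K))) ^ 2)) by ring.
        replace (cos (asin ((s - L) / K)) ^ 2) with (1 - (sin (asin ((s - L) / K))) ^ 2).
        - rewrite sin_asin by lra; field; lra.
        - pose proof (sin2_cos2 (asin ((s - L) / K))) as S; unfold Rsqr in S; lra. }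
      assert (0 < w * (K * cos (asin ((s - L) / K)))) by (repeat apply Rmult_lt_0_compat; lra).
      nra. }
  pose proof (eq_of_derive_eq th _ _ 0 (2 * L) (fun s _ => Dth s) D2 s L Hs ltac:(lra)) as E.
  cbv beta in E.
  replace ((L - L) / K) with 0 in E by (field; lra); rewrite asin_0 in E.
  assert (EL : th L = PI).
  { unfold th; rewrite RInt_point; change (PI + / w * 0 = PI); ring. }
  rewrite EL in E; unfold Rdiv in *; lra.
Qed.

Lemma exists_critical_curve (x0 L : R) :
  0 < x0 -> 0 < L -> 3 * x0 < L ->
  exists g, vert_symmetric L g /\ arclength_param L g /\
            lam_critical x0 L (2 * L / (L + x0)) g.
Proof.
  intros Hx0 HL H3.
  pose (c := x0 / (L + x0)).
  assert (Hc : 0 < c) by (apply Rdiv_lt_0_compat; lra).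
  assert (Hc4 : c < 1 / 4).
  { apply (Rmult_lt_reg_r (L + x0)); [lra|]; unfold c, Rdiv; rewrite Rmult_assoc, Rinv_l; lra. }
  assert (Hcx : (1 - c) * x0 = c * L) by (unfold c; field; lra).
  pose (w := sqrt c).
  assert (Hw2 : w ^ 2 = c) by (apply pow2_sqrt; lra).
  assert (Hw : 0 < w) by (apply sqrt_lt_R0; exact Hc).
  assert (Hw1 : w < 1 / 2) by nra.
  pose proof PI_RGT_0 as Hpi.
  assert (Hsin : 0 < sin (PI * w)) by (apply sin_gt_0; nra).
  assert (Hcos : 0 < cos (PI * w)) by (apply cos_gt_0; nra).
  assert (Hsin1 : sin (PI * w) < 1).
  { pose proof (sin2_cos2 (PI * w)) as S; unfold Rsqr in S; nra. }
  (* The value forced by arcsin(L/K) = pi w, for which the tangent turns exactly once. *)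
  pose (K := L / sin (PI * w)).
  assert (HK : K * sin (PI * w) = L) by (unfold K; field; lra).
  assert (HKL : 0 < L < K).
  { assert (0 < K) by (apply Rdiv_lt_0_compat; lra). nra. }
  destruct (radius_and_angle w K L Hw HKL) as (r & th & Sr & Sth & Pr & Dth & Er2 & Eth).
  rewrite Hw2 in Er2.
  assert (I0 : 0 <= 0 <= 2 * L) by lra. assert (I1 : 0 <= 2 * L <= 2 * L) by lra.
  assert (th_L : th L = PI).
  { rewrite Eth by lra; replace ((L - L) / K) with 0 by (field; lra); rewrite asin_0; field; lra. }
  assert (asin_LK : asin (L / K) = PI * w).
  { replace (L / K) with (sin (PI * w)) by (unfold K; field; lra).
    apply asin_sin; split; nra. }
  assert (th_0 : th 0 = 0).
  { rewrite Eth by lra; replace ((0 - L) / K) with (- (L / K)) by (field; lra).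
    rewrite asin_opp, asin_LK; field; lra. }
  assert (th_refl : forall s, 0 <= s <= 2 * L -> th (2 * L - s) = 2 * PI - th s).
  { intros s Hs; rewrite !Eth by lra.
    replace ((2 * L - s - L) / K) with (- ((s - L) / K)) by (field; lra).
    rewrite asin_opp; field; lra. }
  assert (th_incr : forall s t, s < t -> th s < th t).
  { intros s t Hst; destruct (smooth1_MVT th s t Sth Hst) as (e & _ & E).
    rewrite (is_derive_unique _ _ _ (Dth e)) in E.
    pose proof (Rinv_0_lt_compat _ (Pr e)); nra. }
  assert (th_1 : th (2 * L) = 2 * PI).
  { replace (2 * L) with (2 * L - 0) by ring; rewrite th_refl, th_0 by lra; ring. }
  assert (r_refl : forall s, 0 <= s <= 2 * L -> r (2 * L - s) = r s).
  { intros s Hs; pose proof (Pr s); pose proof (Pr (2 * L - s)).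
    assert (r (2 * L - s) ^ 2 = r s ^ 2) by (rewrite !Er2 by lra; ring). nra. }
  assert (Dr : forall s, 0 <= s <= 2 * L -> Derive r s = - c * (s - L) / r s).
  { intros s Hs; pose proof (Pr s).
    assert (E : Derive (fun s => r s ^ 2) s = Derive (fun s => c * (K ^ 2 - (s - L) ^ 2)) s).
    { apply (Derive_eq_on_interval _ _ 0 (2 * L)); [lra | smooth1_tac | smooth1_tac | exact Er2 | exact Hs]. }
    assert (ex_derive r s) by (apply smooth1_ex_derive, Sr).
    assert (E1 : Derive (fun s => r s ^ 2) s = 2 * r s * Derive r s).
    { apply is_derive_unique; auto_derive; [auto | eta_Derive; ring]. }
    assert (E2 : Derive (fun s => c * (K ^ 2 - (s - L) ^ 2)) s = - 2 * c * (s - L)).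
    { apply is_derive_unique; auto_derive; [auto | ring]. }
    rewrite E1, E2 in E; apply (Rmult_eq_reg_l (2 * r s)); [|lra].
    rewrite E; field; lra. }
  (* the two first integrals, solved for x and y *)
  pose (X := fun s => / (1 - c) * (r s * sin (th s) - c * (s - L) * cos (th s))).
  pose (Y := fun s => / (1 - c) * (r 0 - r s * cos (th s) - c * (s - L) * sin (th s))).
  assert (Ssin : smooth1 (fun s => sin (th s))) by (apply (smooth1_comp sin); [apply smooth1_sin | exact Sth]).
  assert (Scos : smooth1 (fun s => cos (th s))) by (apply (smooth1_comp cos); [apply smooth1_cos | exact Sth]).
  assert (SX : smooth1 X) by (unfold X; smooth1_tac).
  assert (SY : smooth1 Y) by (unfold Y; smooth1_tac).
  assert (Dths : forall s, Derive th s = / r s) by (intro s; apply is_derive_unique, Dth).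
  assert (DX : forall s, 0 <= s <= 2 * L -> Derive X s = cos (th s)).
  { intros s Hs; pose proof (Pr s).
    assert (ex_derive r s) by (apply smooth1_ex_derive, Sr).
    assert (ex_derive th s) by (apply smooth1_ex_derive, Sth).
    apply is_derive_unique; unfold X; auto_derive; [repeat split; auto|]; eta_Derive.
    rewrite Dths, (Dr s Hs); field; lra. }
  assert (DY : forall s, 0 <= s <= 2 * L -> Derive Y s = sin (th s)).
  { intros s Hs; pose proof (Pr s).
    assert (ex_derive r s) by (apply smooth1_ex_derive, Sr).
    assert (ex_derive th s) by (apply smooth1_ex_derive, Sth).
    apply is_derive_unique; unfold Y; auto_derive; [repeat split; auto|]; eta_Derive.
    rewrite Dths, (Dr s Hs); field; lra. }
  assert (H2L : 0 < 2 * L) by lra.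
  assert (DDX : forall s, 0 <= s <= 2 * L -> Derive (Derive X) s = - sin (th s) * / r s).
  { intros s Hs.
    rewrite (Derive_eq_on_interval (Derive X) (fun s => cos (th s)) 0 (2 * L) H2L
      (smooth1_Derive _ SX) Scos DX s Hs).
    assert (ex_derive th s) by (apply smooth1_ex_derive, Sth).
    apply is_derive_unique; auto_derive; [auto | eta_Derive; rewrite Dths; ring]. }
  assert (DDY : forall s, 0 <= s <= 2 * L -> Derive (Derive Y) s = cos (th s) * / r s).
  { intros s Hs.
    rewrite (Derive_eq_on_interval (Derive Y) (fun s => sin (th s)) 0 (2 * L) H2L
      (smooth1_Derive _ SY) Ssin DY s Hs).
    assert (ex_derive th s) by (apply smooth1_ex_derive, Sth).
    apply is_derive_unique; auto_derive; [auto | eta_Derive; rewrite Dths; ring]. }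
  pose (g := fun s => (X s, Y s) : R * R).
  change X with (cx g) in SX, DX, DDX; change Y with (cy g) in SY, DY, DDY.
  assert (US : unit_speed (cx g) (cy g) L).
  { intros s Hs; rewrite DX, DY by exact Hs.
    pose proof (sin2_cos2 (th s)) as S; unfold Rsqr in S; lra. }
  assert (Ek : forall s, 0 <= s <= 2 * L -> curv_num (cx g) (cy g) s = Derive th s).
  { intros s Hs; unfold curv_num; rewrite DX, DY, DDX, DDY, Dths by exact Hs.
    pose proof (sin2_cos2 (th s)) as S; unfold Rsqr in S.
    replace (/ r s) with (/ r s * (sin (th s) * sin (th s) + cos (th s) * cos (th s))) at 3
      by (rewrite S; ring). ring. }
  assert (X_L : X L = 0).
  { unfold X; rewrite th_L, sin_PI; ring. }
  assert (X_0 : X 0 = x0).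
  { unfold X; rewrite th_0, sin_0, cos_0; apply (Rmult_eq_reg_l (1 - c)); [|lra].
    rewrite Hcx; field; lra. }
  assert (Y_0 : Y 0 = 0).
  { unfold Y; rewrite th_0, sin_0, cos_0; ring. }
  assert (X_refl : forall s, 0 <= s <= 2 * L -> X (2 * L - s) = - X s).
  { intros s Hs; unfold X; rewrite th_refl, r_refl by exact Hs.
    replace (2 * PI - th s) with (- th s + 2 * INR 1 * PI) by (simpl; ring).
    rewrite sin_period, cos_period, sin_neg, cos_neg; ring. }
  assert (Y_refl : forall s, 0 <= s <= 2 * L -> Y (2 * L - s) = Y s).
  { intros s Hs; unfold Y; rewrite th_refl, r_refl by exact Hs.
    replace (2 * PI - th s) with (- th s + 2 * INR 1 * PI) by (simpl; ring).
    rewrite sin_period, cos_period, sin_neg, cos_neg; ring. }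
  assert (Y_incr : forall s t, 0 <= s -> s < t -> t <= L -> Y s < Y t).
  { intros s t H0s Hst HtL; destruct (smooth1_MVT Y s t SY Hst) as (e & He & E).
    change Y with (cy g) in E at 3; rewrite DY in E by lra.
    pose proof (th_incr 0 e ltac:(lra)); pose proof (th_incr e L ltac:(lra)).
    assert (0 < sin (th e)) by (apply sin_gt_0; lra). nra. }
  (* X' = cos th changes sign once on the first half: X grows from x0 while th <= pi/2, and
     afterwards it decreases to X(L) = 0. *)
  assert (X_pos : forall s, 0 <= s < L -> 0 < X s).
  { intros s Hs; destruct (Rle_lt_dec (th s) (PI / 2)) as [Hle|Hgt].
    - destruct (Req_dec s 0) as [->|Hs0]; [rewrite X_0; exact Hx0|].
      destruct (smooth1_MVT X 0 s SX ltac:(lra)) as (e & He & E).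
      change X with (cx g) in E at 3; rewrite DX in E by lra.
      pose proof (th_incr 0 e ltac:(lra)); pose proof (th_incr e s ltac:(lra)).
      assert (0 <= cos (th e)) by (apply cos_ge_0; lra). nra.
    - destruct (smooth1_MVT X s L SX ltac:(lra)) as (e & He & E).
      change X with (cx g) in E at 3; rewrite DX in E by lra.
      pose proof (th_incr s e ltac:(lra)); pose proof (th_incr e L ltac:(lra)).
      assert (cos (th e) < 0) by (apply cos_lt_0; lra). nra. }
  (* Each half takes a given height at most once. Points of different halves with the same height
     are mirror images, and these are separated by the sign of X. *)
  assert (Inj : forall s1 s2, 0 <= s1 -> s1 < s2 -> s2 <= 2 * L -> g s1 = g s2 -> False).
  { intros s1 s2 H1 H12 H2 E.
    assert (EX : X s1 = X s2) by exact (f_equal fst E).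
    assert (EY : Y s1 = Y s2) by exact (f_equal snd E).
    destruct (Rle_lt_dec s2 L) as [Ha|Ha].
    { pose proof (Y_incr s1 s2 H1 H12 Ha); lra. }
    rewrite <- (Y_refl s2) in EY by lra; rewrite <- (Ropp_involutive (X s2)), <- X_refl in EX by lra.
    destruct (Rle_lt_dec L s1) as [Hb|Hb].
    { rewrite <- (Y_refl s1) in EY by lra.
      pose proof (Y_incr (2 * L - s2) (2 * L - s1) ltac:(lra) ltac:(lra) ltac:(lra)); lra. }
    destruct (Rtotal_order s1 (2 * L - s2)) as [Hc'|[Hc'|Hc']].
    - pose proof (Y_incr s1 (2 * L - s2) ltac:(lra) ltac:(lra) ltac:(lra)); lra.
    - rewrite <- Hc' in EX; pose proof (X_pos s1 ltac:(lra)); lra.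
    - pose proof (Y_incr (2 * L - s2) s1 ltac:(lra) ltac:(lra) ltac:(lra)); lra. }
  assert (Ad : admissible x0 L g).
  { split; [split; assumption|].
    assert (Sp : forall s, 0 <= s <= 2 * L -> speed g s <> 0).
    { intros s Hs; rewrite (unit_speed_arclength L g US s Hs); lra. }
    split; [exact Sp|]; split; [|split; [|split; [|split]]].
    - intros s Hs; apply curvature_pos_iff; [auto|].
      rewrite Ek, Dths by exact Hs; apply Rinv_0_lt_compat, Pr.
    - intros s1 s2 H1 H2 E; destruct (Rtotal_order s1 s2) as [H|[H|H]]; [exfalso|exact H|exfalso].
      + apply (Inj s1 s2); auto; lra.
      + apply (Inj s2 s1); auto; lra.
    - unfold g; rewrite X_0, Y_0; reflexivity.
    - unfold g; replace (2 * L) with (2 * L - 0) by ring.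
      rewrite X_refl, Y_refl, X_0, Y_0 by lra; reflexivity.
    - intros s Hs; change (0 < Y s); rewrite <- Y_0.
      destruct (Rle_lt_dec s L); [apply Y_incr; lra|].
      rewrite <- (Y_refl s) by lra; apply Y_incr; lra. }
  exists g; split; [|split; [exact (unit_speed_arclength L g US)|]].
  - intros s Hs; exists (2 * L - s); split; [lra|].
    change ((X (2 * L - s), Y (2 * L - s)) = (- X s, Y s)).
    rewrite X_refl, Y_refl by exact Hs; reflexivity.
  - apply lam_critical_of_EL; auto.
    + exact (unit_speed_arclength L g US).
    + intros s Hs.
      rewrite (EL_expr_eq_on_interval _ (Derive th) 0 (2 * L)); auto;
        [|apply smooth1_curv_num; assumption | apply smooth1_Derive, Sth].
      set (k := Derive th).
      assert (Sk : smooth1 k) by (apply smooth1_Derive, Sth).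
      assert (kr : forall s, k s = / r s) by exact Dths.
      (* This is r r' = -c (s-L) in terms of k = 1/r. It gives k'' as a polynomial in k, and the
         Euler-Lagrange expression collapses to 2 - 2c. *)
      assert (D1 : forall s, 0 <= s <= 2 * L -> Derive k s = c * (s - L) * k s ^ 3).
      { intros u Hu; pose proof (Pr u).
        rewrite (Derive_ext k (fun s => / r s) u kr).
        assert (ex_derive r u) by (apply smooth1_ex_derive, Sr).
        rewrite Derive_inv, Dr, kr by (auto; lra); field; lra. }
      assert (D2 : Derive (Derive k) s = c * k s ^ 3 + 3 * c * (s - L) * k s ^ 2 * (c * (s - L) * k s ^ 3)).
      { rewrite (Derive_eq_on_interval (Derive k) (fun s => c * (s - L) * k s ^ 3) 0 (2 * L));
          [| lra | apply smooth1_Derive, Sk | smooth1_tac | exact D1 | exact Hs].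
        assert (ex_derive k s) by (apply smooth1_ex_derive, Sk).
        apply is_derive_unique; auto_derive; [auto|]; eta_Derive.
        rewrite (D1 s Hs); simpl; ring. }
      unfold EL_expr; rewrite D2, (D1 s Hs).
      assert (Hk : 0 < k s) by (rewrite kr; apply Rinv_0_lt_compat, Pr).
      replace (2 * L / (L + x0)) with (2 - 2 * c) by (unfold c; field; lra).
      field; lra.
    + rewrite DX, th_0 by exact I0; apply cos_0.
    + rewrite DY, th_0 by exact I0; apply sin_0.
    + rewrite DX, th_1 by exact I1; apply cos_2PI.
    + rewrite DY, th_1 by exact I1; apply sin_2PI.
Qed.

(** * Necessity for both notions of criticality, and the two equivalences *)

Lemma ap_critical_shape (x0 L : R) (g : curve) :
  0 < x0 -> 0 < L -> arclength_param L g -> ap_critical x0 L g ->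
  3 * x0 < L /\ (forall s, 0 <= s <= 2 * L -> g s = gamma0 x0 L s) /\
  (forall lam, lam_critical x0 L lam g -> lam = 2 * L / (L + x0)).
Proof.
  intros Hx0 HL Arc Cr.
  destruct (euler_lagrange x0 L g HL Cr Arc) as (lam & EL & Y0 & Y1 & Hlam).
  destruct (critical_shape x0 L lam g Hx0 HL (proj1 Cr) Arc EL Y0 Y1) as (H3 & E & Hg).
  split; [exact H3|]; split; [exact Hg|].
  intros lam' Cl; rewrite <- E; exact (Hlam lam' Cl).
Qed.

Theorem mainTheorem7 (x0 L : R) (Hx0 : 0 < x0) (HL : 0 < L) :
  (* (i) *)
  ((exists g : curve, vert_symmetric L g /\ arclength_param L g /\ ap_critical x0 L g)
     <-> 3 * x0 < L) /\
  (3 * x0 < L ->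
     forall g : curve, vert_symmetric L g -> arclength_param L g -> ap_critical x0 L g ->
     forall s, 0 <= s <= 2 * L -> g s = gamma0 x0 L s) /\
  (* (ii) *)
  (forall lam : R,
     ((exists g : curve, vert_symmetric L g /\ arclength_param L g /\ lam_critical x0 L lam g)
        <-> (3 * x0 < L /\ lam = 2 * L / (L + x0))) /\
     (3 * x0 < L -> lam = 2 * L / (L + x0) ->
        forall g : curve, vert_symmetric L g -> arclength_param L g -> lam_critical x0 L lam g ->
        forall s, 0 <= s <= 2 * L -> g s = gamma0 x0 L s)).
Proof.
  split; [|split].
  - split.
    + intros (g & _ & Arc & Cr); exact (proj1 (ap_critical_shape x0 L g Hx0 HL Arc Cr)).
    + intro H3; destruct (exists_critical_curve x0 L Hx0 HL H3) as (g & Sym & Arc & Cl).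
      exists g; split; [exact Sym|]; split; [exact Arc|].
      exact (lam_critical_ap_critical _ _ _ _ Cl).
  - intros _ g _ Arc Cr.
    exact (proj1 (proj2 (ap_critical_shape x0 L g Hx0 HL Arc Cr))).
  - intro lam; split; [split|].
    (* Restricting to area-preserving variations reduces the shape of the curve to case (i); the
       full criticality is used once more to determine [lam]. *)
    + intros (g & _ & Arc & Cl); pose proof (lam_critical_ap_critical _ _ _ _ Cl) as Cr.
      destruct (ap_critical_shape x0 L g Hx0 HL Arc Cr) as (H3 & _ & Hlam).
      split; [exact H3 | exact (Hlam lam Cl)].
    + intros [H3 ->]; exact (exists_critical_curve x0 L Hx0 HL H3).
    + intros _ _ g _ Arc Cl; pose proof (lam_critical_ap_critical _ _ _ _ Cl) as Cr.
      exact (proj1 (proj2 (ap_critical_shape x0 L g Hx0 HL Arc Cr))).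
Qed.
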